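(* Let $\varphi:\mathbb C^+\to\mathcal L(\mathcal U;\mathcal Y)$ be an operator Schur function, let $S_s$ be the conservative model on $\mathcal H_s$ with main operator $A_s$, and fix $\beta\in\mathbb C^+$. The quotient space $$\mathcal H_{s,-1}:=\Big\{\begin{bmatrix}x_1\\ x_2\end{bmatrix}:\mathbb C^+\times\mathbb C^+\to\begin{bmatrix}\mathcal Y\\ \mathcal U\end{bmatrix}\text{ analytic}\;\Big|\;R_\beta\begin{bmatrix}x_1\\ x_2\end{bmatrix}\in\mathcal H_s\Big\}\Big/\mathcal Z_s$$ is a Hilbert space with the norm $\Big\|\begin{bmatrix}z_1\\ z_2\end{bmatrix}+\mathcal Z_s\Big\|_{\mathcal H_{s,-1}}=\Big\|R_\beta\begin{bmatrix}z_1\\ z_2\end{bmatrix}\Big\|_{\mathcal H_s}$. 1. The map $\iota:\begin{bmatrix}x_1\\ x_2\end{bmatrix}\mapsto\begin{bmatrix}x_1\\ x_2\end{bmatrix}+\mathcal Z_s$ embeds $\mathcal H_s$ continuously into $\mathcal H_{s,-1}$ as a dense subspace. A given element $\begin{bmatrix}z_1\\ z_2\end{bmatrix}+\mathcal Z_s\in\mathcal H_{s,-1}$ is of the form $\iota\begin{bmatrix}x_1\\ x_2\end{bmatrix}$ for some $\begin{bmatrix}x_1\\ x_2\end{bmatrix}\in\mathcal H_s$ if and only if the function $R_\alpha\begin{bmatrix}z_1\\ z_2\end{bmatrix}$ is not only in $\mathcal H_s$ but in fact in $\mathrm{dom}(A_s)\subset\mathcal H_s$, for some, or equivalently for all, $\alpha\in\mathbb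 C^+$. When $\begin{bmatrix}z_1\\ z_2\end{bmatrix}+\mathcal Z_s=\iota\begin{bmatrix}x_1\\ x_2\end{bmatrix}$, the representative $\begin{bmatrix}x_1\\ x_2\end{bmatrix}\in\mathcal H_s$ of the equivalence class $\begin{bmatrix}z_1\\ z_2\end{bmatrix}+\mathcal Z_s$ is uniquely determined by the condition $\lim_{\operatorname{Re}\eta\to+\infty}x_1(\eta)=0$. 2. When $\mathcal H_s$ is identified with the linear submanifold $\iota\mathcal H_s$ of $\mathcal H_{s,-1}$, the operator $A_{s,-1}$, defined for all $\begin{bmatrix}x_1\\ x_2\end{bmatrix}\in\mathcal H_s$ by $$A_{s,-1}\Big(\begin{bmatrix}x_1\\ x_2\end{bmatrix}+\mathcal Z_s\Big)=\Big((\mu,\mu_* )\mapsto\begin{bmatrix}\mu x_1(\mu)\\ -\mu_*x_2(\mu_* )\end{bmatrix}\Big)+\mathcal Z_s,$$ is the unique extension of $A_s$ to a closed operator on $\mathcal H_{s,-1}$ (with domain $\mathcal H_s$). Moreover $(\alpha-A_{s,-1})^{-1}=R_\alpha|_{\mathcal H_{s,-1}}$ for all $\alpha\in\mathbb C^+$, and $(\beta-A_{s,-1})^{-1}$ is a unitary operator from $\mathcal H_{s,-1}$ onto $\mathcal H_s$. 3. With the extrapolation space of $\mathcal H_s$ taken to be the quotient space $\mathcal H_{s,-1}=\Big\{\begin{bmatrix}x_1\\ x_2\end{bmatrix}:\mathbb C^+\times\mathbb C^+\to\begin{bmatrix}\mathcal Y\\ \mathcal U\end{bmatrix}\text{ analytic}\;\Big|\;R_\beta\begin{bmatrix}x_1\\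 x_2\end{bmatrix}\in\mathcal H_s\Big\}\Big/\mathcal Z_s$ and $\iota\mathcal H_s$ identified with $\mathcal H_s$, the control operator $B_s:\mathcal U\to\mathcal H_{s,-1}$ of $S_s$ is $$B_su=\Big((\mu,\mu_* )\mapsto\begin{bmatrix}\varphi(\mu)\\ 1\end{bmatrix}u\Big)+\mathcal Z_s,\qquad u\in\mathcal U.$$
   Context: All Hilbert spaces are complex; $\begin{bmatrix}\mathcal X\\ \mathcal U\end{bmatrix}$ is the orthogonal direct sum; $1$ denotes an identity operator; $\mathbb C^+=\{\operatorname{Re}\lambda>0\}$. $\mathcal U,\mathcal Y$ are separable Hilbert spaces. A Schur function is analytic with contractive values. $\widetilde\varphi(\mu):=\varphi(\overline\mu)^*$. Removable singularities are always removed. $\mathcal H_s$ is the RKHS of functions $(\mu,\mu_* )\mapsto\begin{bmatrix}x_1(\mu)\\ x_2(\mu_* )\end{bmatrix}\in\begin{bmatrix}\mathcal Y\\ \mathcal U\end{bmatrix}$ on $\mathbb C^+\times\mathbb C^+$ with (positive) reproducing kernel $$K_s(\mu,\mu_*,\lambda,\lambda_* )=\begin{bmatrix}\frac{1-\varphi(\mu)\varphi(\lambda)^*}{\mu+\overline\lambda}&\frac{\varphi(\overline{\lambda_*})-\varphi(\mu)}{\mu-\overline{\lambda_*}}\\ \frac{\widetilde\varphi(\overline\lambda)-\widetilde\varphi(\mu_* )}{\mu_*-\overline\lambda}&\frac{1-\widetilde\varphi(\mu_* )\widetilde\varphi(\lambda_* )^*}{\mu_*+\overline{\lambda_*}}\end{bmatrix}.$$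 Throughout, an analytic function $\begin{bmatrix}x_1\\ x_2\end{bmatrix}$ on $\mathbb C^+\times\mathbb C^+$ means $(\mu,\mu_* )\mapsto\begin{bmatrix}x_1(\mu)\\ x_2(\mu_* )\end{bmatrix}$ with $x_1:\mathbb C^+\to\mathcal Y$ and $x_2:\mathbb C^+\to\mathcal U$ analytic. For $\alpha\in\mathbb C^+$ define on such functions $$R_\alpha\begin{bmatrix}x_1\\ x_2\end{bmatrix}:=(\mu,\mu_* )\mapsto\begin{bmatrix}\frac{x_1(\mu)-x_1(\alpha)}{\alpha-\mu}\\ \frac{x_2(\mu_* )-\widetilde\varphi(\mu_* )x_1(\alpha)}{\alpha+\mu_*}\end{bmatrix}.$$ $\mathcal Z_s:=\Big\{(\mu,\mu_* )\mapsto\begin{bmatrix}1\\ \widetilde\varphi(\mu_* )\end{bmatrix}\gamma\;\Big|\;\gamma\in\mathcal Y\Big\}$; this is the kernel of every $R_\alpha$, so $R_\alpha$ is well defined on cosets modulo $\mathcal Z_s$. The model $S_s=\begin{bmatrix}A_s\&B_s\\ C_s\&D_s\end{bmatrix}:\begin{bmatrix}\mathcal H_s\\ \mathcal U\end{bmatrix}\supset\mathrm{dom}(S_s)\to\begin{bmatrix}\mathcal H_s\\ \mathcal Y\end{bmatrix}$: $\begin{bmatrix}x\\ u\end{bmatrix}\in\mathrm{dom}(S_s)$ iff there is a (unique) $y\in\mathcal Y$ such that $\begin{bmatrix}z_1(\mu)\\ z_2(\mu_* )\end{bmatrix}:=\begin{bmatrix}\mu x_1(\mu)\\ -\mu_*x_2(\mu_*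 )\end{bmatrix}+\begin{bmatrix}\varphi(\mu)\\ 1\end{bmatrix}u-\begin{bmatrix}1\\ \widetilde\varphi(\mu_* )\end{bmatrix}y$ defines an element of $\mathcal H_s$, and then $A_s\&B_s\begin{bmatrix}x\\ u\end{bmatrix}=\begin{bmatrix}z_1\\ z_2\end{bmatrix}$, $C_s\&D_s\begin{bmatrix}x\\ u\end{bmatrix}=y$. It is a conservative system node; its main operator is $A_sx=A_s\&B_s\begin{bmatrix}x\\ 0\end{bmatrix}$, $\mathrm{dom}(A_s)=\{x:\begin{bmatrix}x\\ 0\end{bmatrix}\in\mathrm{dom}(S_s)\}$, the generator of a contraction semigroup, so $\mathbb C^+\subset\mathrm{res}(A_s)$. Abstractly, the extrapolation space of a generator $A$ on $\mathcal X$ with rigging parameter $\beta$ is the completion of $\mathcal X$ in the norm $\|(\beta-A)^{-1}x\|$, $A_{-1}$ is the continuous extension of $A$ to $\mathcal X$ with values in it, and the control operator $B$ is the unique bounded operator from $\mathcal U$ to it with $A\&B=\begin{bmatrix}A_{-1}&B\end{bmatrix}$ on the domain of the system node. *)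

(* Defs.v *)
From HB Require Import structures.
From mathcomp Require Import all_boot all_order all_algebra generic_quotient.
From mathcomp Require Import complex.
From mathcomp Require Import all_classical all_reals all_analysis.

Set Implicit Arguments.
Unset Strict Implicit.
Unset Printing Implicit Defensive.

Import Order.TTheory GRing.Theory Num.Theory.
Import numFieldNormedType.Exports.

Local Open Scope classical_set_scope.
Local Open Scope ring_scope.
Local Open Scope complex_scope.

(** * Complex Hilbert spaces *)

Definition inner_product (R : realType) (V : normedModType R[i])
    (f : V -> V -> R[i]) : Prop :=
  [/\ forall a x y z, f (a *: x + y) z = a * f x z + f y z,
      forall x y, f y x = (f x y)^* &
      forall x, f x x = `|x| ^+ 2].

Definition complete_space (R : realType) (V : normedModType R[i]) : Prop :=
  forall F : set_system V, ProperFilter F -> cauchy F -> cvg F.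

Definition hilbert_space (R : realType) (V : normedModType R[i])
    (f : V -> V -> R[i]) : Prop :=
  inner_product f /\ complete_space V.

HB.mixin Record isHilbert (R : realType) V of CompleteNormedModule R[i] V := {
  inner : V -> V -> R[i];
  innerP : inner_product inner }.

#[short(type="hilbertType")]
HB.structure Definition Hilbert (R : realType) :=
  {V of CompleteNormedModule R[i] V & isHilbert R V}.

Definition separable (T : topologicalType) : Prop :=
  exists2 A : set T, countable A & dense A.

Definition unitary (R : realType) (V W : normedModType R[i])
    (ipV : V -> V -> R[i]) (ipW : W -> W -> R[i]) (T : V -> W) : Prop :=
  [/\ linear T, bijective T & forall x y, ipW (T x) (T y) = ipV x y].

(* Every bounded operator between Hilbert spaces has exactly one adjoint; the
   zero map is the value taken when there is none. *)
Definition is_adjoint (R : realType) (U Y : hilbertType R)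
    (T : {linear U -> Y}) (S : {linear Y -> U}) : Prop :=
  forall u y, inner (T u) y = inner u (S y).

Definition adjoint (R : realType) (U Y : hilbertType R)
    (T : {linear U -> Y}) : {linear Y -> U} :=
  match pselect (exists S, is_adjoint T S) with
  | left exS => projT1 (cid exS)
  | right _ => \0
  end.

(** * Analytic functions on the right half-plane *)

Definition rhp (R : realType) := {l : R[i] | 0 < complex.Re l}.

Lemma conj_rhp_subproof (R : realType) (l : rhp R) :
  0 < complex.Re (val l)^*.
Proof. by case: l => -[a b]. Qed.

Definition conj_rhp (R : realType) (l : rhp R) : rhp R :=
  Sub (val l)^* (conj_rhp_subproof l).

Section Analytic.
Context {R : realType} {V : normedModType R[i]}.
Implicit Types f : rhp R -> V.

Definition extend0 f : R[i]^o -> V := fun l => oapp f 0 (insub l).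

Definition derivable_rhp f (a : rhp R) : Prop :=
  derivable (extend0 f) (val a) 1.

Definition deriv_rhp f (a : rhp R) : V := 'D_1 (extend0 f) (val a).

Definition analytic f : Prop := forall a, derivable_rhp f a.

(* (f m - f a) / (a - m), with the singularity at m = a removed. *)
Definition diff_quot f (a m : rhp R) : V :=
  if m == a then - deriv_rhp f a
  else (val a - val m)^-1 *: (f m - f a).

End Analytic.

(* Analyticity is in the operator norm: [D] is the derivative at [a]. *)
Definition schur (R : realType) (U Y : hilbertType R)
    (phi : rhp R -> {linear U -> Y}) : Prop :=
  (forall l u, `|phi l u| <= `|u|) /\
  forall a, exists D : {linear U -> Y}, forall e : R[i], 0 < e ->
    exists2 d : R[i], 0 < d & forall m, `|val m - val a| < d ->
      forall u, `|phi m u - phi a u - (val m - val a) *: D u|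
                <= e * `|val m - val a| * `|u|.

(** * The space with kernel K_s *)

(* The pair (x1, x2) stands for the function (m, ms) |-> (x1 m, x2 ms), which
   determines x1 and x2. *)
Definition fpair (R : realType) (U Y : hilbertType R) : Type :=
  ((rhp R -> Y) * (rhp R -> U))%type.
HB.instance Definition _ (R : realType) (U Y : hilbertType R) :=
  GRing.Lmodule.on (fpair U Y).

(* A Hilbert space of functions with reproducing kernel K is a Hilbert space
   with an injective linear map [rk_fun] reading its elements as functions;
   [K l ls y u] is the function K(., ., l, ls) applied to the vector (y, u). *)
Record rkhs (R : realType) (U Y : hilbertType R)
    (K : rhp R -> rhp R -> Y -> U -> fpair U Y) := Rkhs {
  rk_space :> hilbertType R;
  rk_fun : {linear rk_space -> fpair U Y};
  rk_inj : injective rk_fun;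
  rk_reproducing : forall l ls y u, exists2 k : rk_space,
    rk_fun k = K l ls y u &
    forall x, inner ((rk_fun x).1 l) y + inner ((rk_fun x).2 ls) u
              = inner x k }.
Arguments rk_fun {R U Y K r}.

Section Model.
Context {R : realType} {U Y : hilbertType R}.
Variable phi : rhp R -> {linear U -> Y}.

Definition phit (m : rhp R) : {linear Y -> U} := adjoint (phi (conj_rhp m)).

(* The off-diagonal entries are difference quotients: with c the conjugate of
   ls, (phi(c) - phi(m)) / (m - c) = (phi(m) - phi(c)) / (c - m). *)
Definition Ks (l ls : rhp R) (y : Y) (u : U) : fpair U Y :=
  (fun m => (val m + (val l)^*)^-1 *: (y - phi m (adjoint (phi l) y))
            + diff_quot (fun m' => phi m' u) (conj_rhp ls) m,
   fun ms => diff_quot (fun m' => phit m' y) (conj_rhp l) ms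
            + (val ms + (val ls)^*)^-1 *: (u - phit ms (adjoint (phit ls) u))).

Definition Rop (a : rhp R) (x : fpair U Y) : fpair U Y :=
  (fun m => diff_quot x.1 a m,
   fun ms => (val a + val ms)^-1 *: (x.2 ms - phit ms (x.1 a))).

Definition Zfun (g : Y) : fpair U Y := (fun=> g, fun ms => phit ms g).

Definition Zs : set (fpair U Y) := range Zfun.

Definition mulvar (x : fpair U Y) : fpair U Y :=
  (fun m => val m *: x.1 m, fun ms => - (val ms *: x.2 ms)).

Definition inputfun (u : U) : fpair U Y := (fun m => phi m u, fun=> u).

Variable H : rkhs Ks.

(* (x, u) is in dom(S_s), with A_s&B_s (x, u) = z and C_s&D_s (x, u) = y. *)
Definition Ss (x : H) (u : U) (z : H) (y : Y) : Prop :=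
  rk_fun z = mulvar (rk_fun x) + inputfun u - Zfun y.

(* Partially defined operators are given by their graphs. *)
Definition AsBs : set ((H * U) * H) := [set t | exists y, Ss t.1.1 t.1.2 t.2 y].

Definition As : set (H * H) := [set p | AsBs ((p.1, 0), p.2)].

(* The element of H_s which is the function R_a z; used when there is one. *)
Definition Rval (a : rhp R) (z : fpair U Y) : H :=
  xget 0 [set x : H | rk_fun x = Rop a z].

Variable beta : rhp R.

(* The numerator of H_{s,-1}. *)
Definition Es : set (fpair U Y) :=
  [set z | [/\ analytic z.1, analytic z.2 &
               exists x : H, rk_fun x = Rop beta z]].

End Model.
Arguments AsBs {R U Y phi} H.
Arguments As {R U Y phi} H.
Arguments Rval {R U Y phi} H.
Arguments Es {R U Y phi} H beta.

(** * Quotient modules *)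

Section ModuleQuotient.
Context {K : pzRingType} {V : lmodType K}.
Variable I : submodClosed V.

Definition submod_pred : V -> bool := fun v => v \in I.

Fact submod_pred_zmod : zmod_closed submod_pred.
Proof.
split=> [|x y xI yI]; rewrite unfold_in /submod_pred ?rpred0//.
by rewrite -scaleN1r rpredD// rpredZ.
Qed.
HB.instance Definition _ :=
  GRing.isZmodClosed.Build V submod_pred submod_pred_zmod.

Let J := GRing.ZmodClosed.clone V submod_pred _.

Definition lmod_quot : Type := Quotient.quot J.
HB.instance Definition _ := GRing.Zmodule.on lmod_quot.
HB.instance Definition _ := Quotient.on lmod_quot.
HB.instance Definition _ := Choice.on lmod_quot.

Definition coset (v : V) : lmod_quot := \pi_lmod_quot%qT v.

Lemma eq_coset x y : (coset x == coset y) = (x - y \in I).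
Proof. by rewrite -(Quotient.idealrBE J). Qed.

Lemma cosetK q : coset (repr q) = q.
Proof. exact: reprK. Qed.

Lemma cosetD x y : coset (x + y) = coset x + coset y.
Proof. exact: (Quotient.pi_add J). Qed.

Definition scale_quot (a : K) (q : lmod_quot) : lmod_quot :=
  coset (a *: repr q).

Lemma scale_cosetE a x : scale_quot a (coset x) = coset (a *: x).
Proof.
apply/eqP; rewrite eq_coset -scalerBr rpredZ//.
by rewrite -eq_coset cosetK.
Qed.

Fact scale_quotA a b q : scale_quot a (scale_quot b q) = scale_quot (a * b) q.
Proof. by rewrite -(cosetK q) !scale_cosetE scalerA. Qed.

Fact scale_quot1 : left_id 1 scale_quot.
Proof. by move=> q; rewrite -(cosetK q) scale_cosetE scale1r. Qed.

Fact scale_quotDr : right_distributive scale_quot +%R.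
Proof.
move=> a p q; rewrite -(cosetK p) -(cosetK q) -cosetD !scale_cosetE.
by rewrite scalerDr cosetD.
Qed.

Fact scale_quotDl q : {morph scale_quot^~ q : a b / a + b}.
Proof.
by move=> a b; rewrite -(cosetK q) !scale_cosetE scalerDl cosetD.
Qed.

HB.instance Definition _ := GRing.Zmodule_isLmodule.Build K lmod_quot
  scale_quotA scale_quot1 scale_quotDr scale_quotDl.

Fact coset_is_linear : linear coset.
Proof. by move=> a x y; rewrite cosetD -scale_cosetE. Qed.
HB.instance Definition _ :=
  GRing.isLinear.Build K V lmod_quot *:%R coset coset_is_linear.

End ModuleQuotient.
Arguments coset {K V I}.

Section Linearity.
Context {R : realType} {V : normedModType R[i]}.
Implicit Types f g : rhp R -> V.

Lemma extend0_val f (a : rhp R) : extend0 f (val a) = f a.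
Proof. by rewrite /extend0 valK. Qed.

Lemma extend0_linear (c : R[i]) f g :
  extend0 (c *: f + g) = c *: extend0 f + extend0 g.
Proof.
apply/funext => l; rewrite /extend0 /= !fctE.
by case: insubP => [? _ _|_] //=; rewrite scaler0 addr0.
Qed.

Lemma analytic_linear (c : R[i]) f g :
  analytic f -> analytic g -> analytic (c *: f + g).
Proof.
move=> af ag a; rewrite /derivable_rhp extend0_linear.
by apply: derivableD; [apply: derivableZ; exact: af|exact: ag].
Qed.

Lemma diff_quot_linear (c : R[i]) f g a m : analytic f -> analytic g ->
  diff_quot (c *: f + g) a m = c *: diff_quot f a m + diff_quot g a m.
Proof.
move=> af ag; rewrite /diff_quot; case: ifP => _.
  rewrite /deriv_rhp extend0_linear deriveD ?deriveZ; [|exact: af|..|exact: ag].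
    by rewrite opprD scalerN.
  by apply: derivableZ; exact: af.
rewrite !fctE /= scalerA mulrC -scalerA -scalerDr; congr (_ *: _).
by rewrite scalerBr opprD addrACA.
Qed.

Lemma analytic0 : analytic (0 : rhp R -> V).
Proof.
move=> a; have -> : (0 : rhp R -> V) = fun=> 0 by [].
rewrite /derivable_rhp.
have -> : extend0 (fun=> 0) = (fun=> 0 : V).
  by apply/funext => l; rewrite /extend0; case: insubP.
exact: derivable_cst.
Qed.

Lemma near_rhp (a : rhp R) :
  \forall l \near (val a : R[i]^o), 0 < complex.Re (l : R[i]).
Proof.
have a0 : 0 < ((complex.Re (val a))%:C : R[i]) by rewrite ltcR (valP a).
near=> l.
have : `|(val a : R[i]^o) - l| < (complex.Re (val a))%:C.
  by near: l; exact: cvgr_dist_lt.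
move=> /(le_lt_trans (normc_ge_Re _)); rewrite ltcR => /(le_lt_trans (ler_norm _)).
by rewrite raddfB /= ltrBlDr ltrDl.
Unshelve. all: by end_near. Qed.

Lemma deriv_rhp_cst (c : V) a : deriv_rhp (fun=> c) a = 0.
Proof.
rewrite /deriv_rhp -[RHS](@derive_cst _ R[i]^o V c (val a) 1).
apply: near_eq_derive.
apply: filterS (near_rhp a) => l l0.
by rewrite /extend0 insubT.
Qed.

Lemma diff_quot_cst (c : V) a m : diff_quot (fun=> c) a m = 0.
Proof.
by rewrite /diff_quot deriv_rhp_cst oppr0 subrr scaler0; case: ifP.
Qed.

End Linearity.

(** * The quotient space H_{s,-1} *)

Section Rop.
Context {R : realType} {U Y : hilbertType R}.
Variable phi : rhp R -> {linear U -> Y}.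

Lemma Rop_linear a (c : R[i]) (z w : fpair U Y) :
    analytic z.1 -> analytic w.1 ->
  Rop phi a (c *: z + w) = c *: Rop phi a z + Rop phi a w.
Proof.
move=> az aw; congr pair; apply/funext => m /=; rewrite !fctE /=.
  by rewrite -diff_quot_linear.
rewrite linearP /= opprD addrACA -scalerBr scalerDr; congr (_ + _).
by rewrite !scalerA mulrC.
Qed.

Lemma Rop_Zfun a g : Rop phi a (Zfun phi g) = 0.
Proof.
congr pair; apply/funext => m /=; first exact: diff_quot_cst.
by rewrite subrr scaler0.
Qed.

Lemma Rop_eq0 a z : Rop phi a z = 0 -> Zs phi z.
Proof.
move=> Rz; exists (z.1 a) => //; case: z Rz => z1 z2 Rz.
have R1 m : diff_quot z1 a m = 0 := congr1 (fun x => x.1 m) Rz.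
have R2 m : (val a + val m)^-1 *: (z2 m - phit phi m (z1 a)) = 0 :=
  congr1 (fun x => x.2 m) Rz.
congr pair; apply/funext => m.
  have := R1 m; rewrite /diff_quot /=.
  case: eqVneq => [->//|ma] /eqP; rewrite scaler_eq0 invr_eq0 subr_eq0.
  case/orP => [/eqP/val_inj am|]; first by rewrite am eqxx in ma.
  by rewrite subr_eq0 => /eqP.
have /eqP := R2 m.
rewrite scaler_eq0 invr_eq0 subr_eq0 => /orP[/eqP am0|/eqP//].
have := addr_gt0 (valP a) (valP m).
by rewrite -raddfD /= am0 ltxx.
Qed.

Lemma Zs_linear (c : R[i]) z w : Zs phi z -> Zs phi w -> Zs phi (c *: z + w).
Proof.
move=> [g _ <-] [h _ <-]; exists (c *: g + h) => //.
by congr pair; apply/funext => m; rewrite !fctE //= linearP.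
Qed.

Lemma Zfun0 : Zfun phi 0 = 0.
Proof. by congr pair; apply/funext => m /=; rewrite linear0. Qed.

Lemma Zs0 : Zs phi 0.
Proof. by exists 0 => //; exact: Zfun0. Qed.

End Rop.

Section Extrapolation.
Context {R : realType} {U Y : hilbertType R}.
Context {phi : rhp R -> {linear U -> Y}}.
Variables (H : rkhs (Ks phi)) (beta : rhp R).

Definition Es_pred : {pred fpair U Y} := [pred z | `[< Es H beta z >]].

Fact Es_submod_closed : submod_closed Es_pred.
Proof.
split=> [|c z w]; rewrite !inE.
  split; [exact: analytic0|exact: analytic0|exists 0].
  by rewrite linear0 -[in RHS](Zfun0 phi) Rop_Zfun.
move=> [az1 az2 [x xz]] [aw1 aw2 [y yw]].
split; [exact: analytic_linear|exact: analytic_linear|exists (c *: x + y)].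
by rewrite Rop_linear// linearP xz yw.
Qed.
HB.instance Definition _ := GRing.isSubmodClosed.Build R[i] (fpair U Y)
  Es_pred Es_submod_closed.

Definition Es_type : Type := {z : fpair U Y | z \in Es_pred}.
HB.instance Definition _ := SubType.on Es_type.
HB.instance Definition _ := Choice.on Es_type.
HB.instance Definition _ := [SubChoice_isSubLmodule of Es_type by <:].

Definition Es_Zs : {pred Es_type} := [pred z | `[< Zs phi (val z) >]].

Fact Es_Zs_submod_closed : submod_closed Es_Zs.
Proof.
by split=> [|c z w]; rewrite !inE; [exact: Zs0|exact: Zs_linear].
Qed.
HB.instance Definition _ := GRing.isSubmodClosed.Build R[i] Es_type
  Es_Zs Es_Zs_submod_closed.

Definition Hm1 : Type := lmod_quot (GRing.SubmodClosed.clone _ _ Es_Zs _).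
HB.instance Definition _ := GRing.Lmodule.on Hm1.

(* The class of z modulo Z_s; used for z in the numerator only. *)
Definition class_of (z : fpair U Y) : Hm1 :=
  if (insub z : option Es_type) is Some z' then coset z' else 0.

(* R_a acting on classes, with values in H_s. *)
Definition Rquot (a : rhp R) (q : Hm1) : H := Rval H a (val (repr q)).

Lemma RvalE a z x : rk_fun x = Rop phi a z -> Rval H a z = x.
Proof.
by move=> xz; apply: rk_inj; rewrite xz /Rval; case: xgetP => [y _ ->//|/(_ x)].
Qed.

Lemma rk_fun_Rval (z : Es_type) : rk_fun (Rval H beta (val z)) = Rop phi beta (val z).
Proof.
by have := valP z; rewrite inE => -[_ _ [x xz]]; rewrite (RvalE xz).
Qed.

Lemma Rval_linear (c : R[i]) (z w : Es_type) :
  Rval H beta (val (c *: z + w)) = c *: Rval H beta (val z) + Rval H beta (val w).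
Proof.
apply: RvalE; rewrite linearP !rk_fun_Rval Rop_linear//.
  by have := valP z; rewrite inE => -[].
by have := valP w; rewrite inE => -[].
Qed.

Lemma Rval_eq0 (z : Es_type) : (Rval H beta (val z) == 0) = (z \in Es_Zs).
Proof.
apply/eqP/asboolP => [z0|].
  by apply: (@Rop_eq0 _ _ _ _ beta); rewrite -rk_fun_Rval z0 linear0.
by case=> g _ zE; apply: RvalE; rewrite linear0 -zE Rop_Zfun.
Qed.

Lemma Rquot_coset (z : Es_type) : Rquot beta (coset z) = Rval H beta (val z).
Proof.
have : (repr (coset z : Hm1) - z) \in Es_Zs by rewrite -eq_coset cosetK.
rewrite -Rval_eq0 addrC -scaleN1r Rval_linear scaleN1r addrC subr_eq0.
by move=> /eqP.
Qed.

Lemma Rquot_linear : linear (Rquot beta).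
Proof.
move=> c p q; rewrite -(cosetK p) -(cosetK q) -linearP !Rquot_coset.
exact: Rval_linear.
Qed.

Lemma Rquot_eq0 q : Rquot beta q = 0 -> q = 0.
Proof.
rewrite -(cosetK q) Rquot_coset => /eqP; rewrite Rval_eq0 => qZ.
by apply/eqP; rewrite -(linear0 coset) eq_coset subr0.
Qed.

(* The norm z + Z_s |-> ||R_beta z|| of H_{s,-1}; the topology follows. *)
Definition Hm1_norm (q : Hm1) : R[i] := `|Rquot beta q|.

Fact Hm1_norm_triangle p q : Hm1_norm (p + q) <= Hm1_norm p + Hm1_norm q.
Proof.
by rewrite /Hm1_norm -{1}(scale1r p) Rquot_linear scale1r ler_normD.
Qed.

Fact Hm1_normZ c q : Hm1_norm (c *: q) = `|c| * Hm1_norm q.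
Proof.
have R0 : Rquot beta 0 = 0.
  by have := Rquot_linear (-1) 0 0; rewrite scaler0 addr0 scaleN1r addNr.
by rewrite /Hm1_norm -(addr0 (c *: q)) Rquot_linear R0 addr0 normrZ.
Qed.

Fact Hm1_norm_eq0 q : Hm1_norm q = 0 -> q = 0.
Proof. by move=> /eqP; rewrite normr_eq0 => /eqP; exact: Rquot_eq0. Qed.

HB.instance Definition _ := Lmodule_isNormed.Build R[i] Hm1
  Hm1_norm_triangle Hm1_normZ Hm1_norm_eq0.

(* The embedding x |-> x + Z_s of H_s. *)
Definition iota_s (x : H) : Hm1 := class_of (rk_fun x).

Definition Am1 (x : H) : Hm1 := class_of (mulvar (rk_fun x)).

Definition Bs (u : U) : Hm1 := class_of (inputfun phi u).

End Extrapolation.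
Arguments class_of {R U Y phi} H beta.
Arguments Rquot {R U Y phi} H beta.
Arguments iota_s {R U Y phi} H beta.
Arguments Am1 {R U Y phi} H beta.
Arguments Bs {R U Y phi} H beta.

(* The filter of Re l -> +oo. *)
Definition Re_pinfty (R : realType) : set_system (rhp R) :=
  filter_from [set: R] (fun M => [set l | M < complex.Re (val l)]).

(** * Unbounded operators, extrapolation spaces and control operators *)

Section Operators.
Context {R : realType}.
Implicit Types V W : normedModType R[i].

Definition dom (T S : Type) (A : set (T * S)) : set T := fst @` A.

Definition is_operator V W (A : set (V * W)) : Prop :=
  [/\ A (0, 0),
      forall (c : R[i]) p q, A p -> A q -> A (c *: p + q) &
      forall w, A (0, w) -> w = 0].

Definition closed_operator V W (A : set (V * W)) : Prop :=
  is_operator A /\ closed A.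

(* The graph of (a - A)^-1. *)
Definition resolvent V (A : set (V * V)) (a : R[i]) : set (V * V) :=
  [set (a *: p.1 - p.2, p.1) | p in A].

(* V, with the embedding i, is a completion of X in the norm
   x |-> ||(b - A)^-1 x||. *)
Definition extrapolation_space (X V : normedModType R[i]) (A : set (X * X))
    (b : R[i]) (i : X -> V) : Prop :=
  [/\ complete_space V, linear i, dense (range i) &
      forall x, exists h, [/\ resolvent A b (x, h),
        forall h', resolvent A b (x, h') -> h' = h & `|i x| = `|h|]].

(* T is a continuous extension of A to X with values in V. *)
Definition continuous_extension (X V : normedModType R[i]) (A : set (X * X))
    (i : X -> V) (T : X -> V) : Prop :=
  [/\ linear T, continuous T & forall p, A p -> T p.1 = i p.2].

(* B is bounded and AB = [T B] on the domain of AB. *)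
Definition control_operator (X V U : normedModType R[i])
    (AB : set ((X * U) * X)) (i : X -> V) (T : X -> V) (B : U -> V) : Prop :=
  [/\ linear B, continuous B &
      forall x u z, AB ((x, u), z) -> i z = T x + B u].

End Operators.

(* Main.v *)
(* The kernel functions of H_s satisfy the energy balance
   2 Re <z, x> = |u|^2 - |y|^2 of a conservative system. This alone makes every
   R_a a bounded operator on H_s: its adjoint is explicit on kernel functions
   and bounded there by 1 / Re a, so that R_a comes from the Riesz
   representation theorem, and likewise for the dual model.

   The elements of H_s are therefore analytic:
   (a - m) (R_a x)_1(m) = x_1(m) - x_1(a) exhibits the difference quotient of
   x_1 as the point value of an element of H_s, and point values satisfy
   2 Re m |x_1(m)|^2 <= |x|^2. The same bound gives x_1(m) -> 0 as
   Re m -> +oo, whence H_s meets Z_s in 0 only.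

   On H_{s,-1} the operators R_a are injective with
   R_a (a iota x - A_{-1} x) = x, and A&B (x, u) = z means
   iota z = A_{-1} x + B u, which reduces all algebraic claims to R_a. The range
   of R_beta on iota H_s, which is dom A_s, is dense: a vector orthogonal to it
   has a constant, hence zero, second component, and then vanishes. *)

Require Import Defs.
From HB Require Import structures.
From mathcomp Require Import all_boot all_order all_algebra.
From mathcomp Require Import complex.
From mathcomp Require Import all_classical all_reals all_analysis.
From mathcomp Require Import ring lra.
Import Order.TTheory GRing.Theory Num.Theory.
Import numFieldNormedType.Exports.

Local Open Scope classical_set_scope.
Local Open Scope ring_scope.

(** * Hilbert spaces *)

Section HilbertSpace.
Local Open Scope complex_scope.
Local Notation "x ^*" := (conjc x) : ring_scope.
Set Implicit Arguments.
Unset Strict Implicit.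
Context {R : realType}.

(** The norm has values in [R[i]], whose order is partial; its real part allows estimates in the
    totally ordered field [R]. *)
Definition rnorm (V : normedZmodType R[i]) (x : V) : R := complex.Re `|x|.

(** * Real-valued norms and the topology they describe *)

Section RealNorm.
Context {V : normedModType R[i]}.
Implicit Types x y : V.

Lemma rnormE (W : normedZmodType R[i]) (x : W) : `|x| = (rnorm x)%:C.
Proof. by rewrite /rnorm RRe_real ?normr_real. Qed.

Lemma rnorm_ge0 (W : normedZmodType R[i]) (x : W) : 0 <= rnorm x.
Proof. by rewrite -lecR -rnormE normr_ge0. Qed.

Lemma rnorm0 (W : normedZmodType R[i]) : rnorm (0 : W) = 0.
Proof. by rewrite /rnorm normr0. Qed.

Lemma rnorm_eq0 (W : normedZmodType R[i]) (x : W) : rnorm x = 0 -> x = 0.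
Proof. by move=> x0; apply/eqP; rewrite -normr_eq0 rnormE x0. Qed.

Lemma rnormN (W : normedZmodType R[i]) (x : W) : rnorm (- x) = rnorm x.
Proof. by rewrite /rnorm normrN. Qed.

Lemma rnormB (W : normedZmodType R[i]) (x y : W) :
  rnorm (x - y) = rnorm (y - x).
Proof. by rewrite /rnorm distrC. Qed.

Lemma rnormD (W : normedZmodType R[i]) (x y : W) :
  rnorm (x + y) <= rnorm x + rnorm y.
Proof. by rewrite -lecR rmorphD /= -!rnormE ler_normD. Qed.

Lemma rnormZ (a : R[i]) x : rnorm (a *: x) = rnorm a * rnorm x.
Proof. by apply: (@complexI R); rewrite rmorphM /= -!rnormE normrZ. Qed.

Lemma rnormM (a b : R[i]) : rnorm (a * b) = rnorm a * rnorm b.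
Proof. by apply: (@complexI R); rewrite rmorphM /= -!rnormE normrM. Qed.

Lemma rnormJ (a : R[i]) : rnorm a^* = rnorm a.
Proof. by rewrite /rnorm normcJ. Qed.

Lemma rnorm_sqr (a : R[i]) : (rnorm a ^+ 2)%:C = a * a^*.
Proof. by rewrite rmorphXn /= -rnormE sqr_normc. Qed.

Lemma rnormC (a : R) : rnorm a%:C = `|a|.
Proof. by rewrite /rnorm normc_def /= expr0n addr0 sqrtr_sqr. Qed.

Lemma Re_le_rnorm (a : R[i]) : complex.Re a <= rnorm a.
Proof.
apply: (le_trans (ler_norm _)).
by rewrite -lecR -rnormE normc_ge_Re.
Qed.

Lemma ReD (a b : R[i]) : complex.Re (a + b) = complex.Re a + complex.Re b.
Proof. by case: a b => [? ?] []. Qed.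
Lemma ReN (a : R[i]) : complex.Re (- a) = - complex.Re a.
Proof. by case: a. Qed.
Lemma ReJ (a : R[i]) : complex.Re a^* = complex.Re a.
Proof. by case: a. Qed.
Lemma ReZ (a : R) (b : R[i]) : complex.Re (a%:C * b) = a * complex.Re b.
Proof. by case: b => b b' /=; rewrite mul0r subr0. Qed.

Lemma rnorm_lt x (e : R) : (`|x| < e%:C) = (rnorm x < e).
Proof. by rewrite rnormE ltcR. Qed.

Lemma lt0cP (e : R[i]) : 0 < e -> exists2 d : R, 0 < d & e = d%:C.
Proof.
move=> e0; exists (complex.Re e); last by rewrite RRe_real// gtr0_real.
by move: e0; rewrite ltcE => /andP[].
Qed.

Lemma nbhs_rnormP x (A : set V) :
  nbhs x A <-> exists2 e : R, 0 < e & forall y, rnorm (x - y) < e -> A y.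
Proof.
split=> [/nbhs_ballP[_/= /lt0cP[e e0 ->] eA]|[e e0 eA]].
  exists e => // y xy; apply: eA; rewrite -ball_normE /ball_/= rnorm_lt//.
apply/nbhs_ballP; exists e%:C; first by rewrite /= ltcR.
by move=> y; rewrite -ball_normE /ball_/= rnorm_lt; exact: eA.
Qed.

Lemma cvg_rnormP (T : Type) (F : set_system T) (f : T -> V) x : Filter F ->
  f @ F --> x <-> forall e : R, 0 < e -> F [set t | rnorm (x - f t) < e].
Proof.
move=> FF; split=> [/cvgrPdist_lt fx e e0|fx].
  have := fx e%:C; rewrite ltcR => /(_ e0); apply: filterS => t.
  by rewrite rnorm_lt.
apply/cvgrPdist_lt => _/lt0cP[e e0 ->]; have := fx _ e0.
by apply: filterS => t /=; rewrite rnorm_lt.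
Qed.

Lemma denseP (A : set V) :
  dense A <-> forall x (e : R), 0 < e -> exists2 y, A y & rnorm (x - y) < e.
Proof.
split=> [dA x e e0|dA O [x Ox] oO].
  have [||y] := dA [set y | rnorm (x - y) < e].
  - by exists x; rewrite /= subrr rnorm0.
  - rewrite (_ : [set _ | _] = ball x e%:C); first exact: ball_open.
    by apply/seteqP; split=> y; rewrite -ball_normE /ball_/= rnorm_lt.
  by case=> ? ?; exists y.
have /nbhs_rnormP[e e0 eO] : nbhs x O by apply: open_nbhs_nbhs.
by have [y Ay /eO Oy] := dA x _ e0; exists y.
Qed.

Lemma closed_dense_eq (A B : set V) :
  dense A -> closed B -> A `<=` B -> forall x, B x.
Proof.
move=> /denseP dA cB AB x; apply: cB => C /nbhs_rnormP[e e0 eC].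
by have [y Ay /eC Cy] := dA x _ e0; exists y; split=> //; exact: AB.
Qed.

End RealNorm.

Lemma linear_le_continuous (V W : normedModType R[i]) (f : V -> W) (M : R) :
  linear f -> (forall x, rnorm (f x) <= M * rnorm x) -> continuous f.
Proof.
move=> lf fM x; apply/cvg_rnormP => e e0; apply/nbhs_rnormP.
(* The sign of M is arbitrary; |M| + 1 is a safe divisor. *)
have M0 : 0 < `|M| + 1 by rewrite ltr_wpDl.
exists (e / (`|M| + 1)) => [|y xy]; first exact: divr_gt0.
have fB : f x - f y = f (x - y).
  by rewrite addrC -scaleN1r -lf scaleN1r addrC.
rewrite /= fB; apply: (le_lt_trans (fM _)).
move: xy; rewrite ltr_pdivlMr// => /(le_lt_trans _); apply.
rewrite mulrC ler_wpM2l ?rnorm_ge0//.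
by rewrite (le_trans (ler_norm _))// lerDl.
Qed.

Lemma closed_equalizer (T : topologicalType) (V : normedModType R[i])
    (f g : T -> V) :
  continuous f -> continuous g -> closed [set x | f x = g x].
Proof.
move=> cf cg; have -> : [set x | f x = g x] = (f - g) @^-1` [set 0].
  apply/seteqP; split=> x /=; first by rewrite !fctE => ->; rewrite subrr.
  by move/eqP; rewrite !fctE subr_eq0 => /eqP.
apply: preimage_closed => [x _|]; first by apply: cvgB; [exact: cf|exact: cg].
exact: (accessible_closed_set1 (hausdorff_accessible (@norm_hausdorff _ V))).
Qed.

(** * Inner products, Riesz representation and density *)

Section InnerProduct.
Context {V : hilbertType R}.
Implicit Types (a : R[i]) (x y z : V).

Lemma innerJ x y : (inner x y)^* = inner y x.
Proof. by have [_ /(_ x y) ->] := @innerP R V. Qed.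

Lemma inner_sqr x : inner x x = (rnorm x ^+ 2)%:C.
Proof. by have [_ _ ->] := @innerP R V; rewrite rnormE rmorphXn. Qed.

Lemma innerP1 a x y z : inner (a *: x + y) z = a * inner x z + inner y z.
Proof. by have [-> _ _] := @innerP R V. Qed.

Lemma inner0l z : inner 0 z = 0 :> R[i].
Proof.
have := innerP1 0 0 0 z; rewrite scale0r addr0 mul0r add0r.
by have := innerP1 1 0 0 z; rewrite scale1r addr0 mul1r => /eqP;
  rewrite -subr_eq0 opprD addNKr oppr_eq0 => /eqP.
Qed.

Lemma innerDl x y z : inner (x + y) z = inner x z + inner y z.
Proof. by rewrite -{1}(scale1r x) innerP1 mul1r. Qed.
Lemma innerZl a x z : inner (a *: x) z = a * inner x z.
Proof. by rewrite -{1}(addr0 (a *: x)) innerP1 inner0l addr0. Qed.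
Lemma innerNl x z : inner (- x) z = - inner x z.
Proof. by rewrite -scaleN1r innerZl mulN1r. Qed.
Lemma innerBl x y z : inner (x - y) z = inner x z - inner y z.
Proof. by rewrite innerDl innerNl. Qed.
Lemma inner0r z : inner z 0 = 0 :> R[i].
Proof. by rewrite -innerJ inner0l conjc0. Qed.
Lemma innerDr x y z : inner z (x + y) = inner z x + inner z y.
Proof. by rewrite -innerJ innerDl rmorphD /= !innerJ. Qed.
Lemma innerZr a x z : inner z (a *: x) = a^* * inner z x.
Proof. by rewrite -innerJ innerZl rmorphM /= !innerJ. Qed.
Lemma innerNr x z : inner z (- x) = - inner z x.
Proof. by rewrite -innerJ innerNl rmorphN /= !innerJ. Qed.
Lemma innerBr x y z : inner z (x - y) = inner z x - inner z y.
Proof. by rewrite innerDr innerNr. Qed.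

Definition innerE := (innerDl, innerDr, innerNl, innerNr, innerZl, innerZr).

Lemma rnormD_sqr x y : rnorm (x + y) ^+ 2 =
  rnorm x ^+ 2 + 2 * complex.Re (inner x y) + rnorm y ^+ 2.
Proof.
have -> : rnorm (x + y) ^+ 2 = complex.Re (inner (x + y) (x + y)).
  by rewrite inner_sqr.
rewrite !innerE !inner_sqr !ReD -(innerJ x y) ReJ /=; ring.
Qed.

Lemma rnormZ_real (a : R) x : rnorm (a%:C *: x) = `|a| * rnorm x.
Proof. by rewrite rnormZ rnormC. Qed.

Lemma Re_inner_le x y : complex.Re (inner x y) <= rnorm x * rnorm y.
Proof.
have [y0|y0] := eqVneq (rnorm y) 0.
  by rewrite (rnorm_eq0 y0) inner0r rnorm0 mulr0.
have {}y0 : 0 < rnorm y by rewrite lt_neqAle eq_sym y0 rnorm_ge0.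
set r := complex.Re _.
(* The squared norm of |y|^2 x - r y is |y|^2 (|x|^2 |y|^2 - r^2), and it is nonnegative. *)
have := rnormD_sqr ((rnorm y ^+ 2)%:C *: x) ((- r)%:C *: y).
rewrite !innerE conjc_real mulrCA ReZ ReZ -/r !rnormZ_real !exprMn !real_normK ?num_real//.
have := sqr_ge0 (rnorm ((rnorm y ^+ 2)%:C *: x + (- r)%:C *: y)).
move: (rnorm (_ + _) ^+ 2) => s s0 sE.
have {s s0 sE} : 0 <= rnorm y ^+ 2 * (rnorm x ^+ 2 * rnorm y ^+ 2 - r ^+ 2).
  by rewrite (le_trans s0)// sE le_eqVlt; apply/orP; left; apply/eqP; ring.
rewrite pmulr_rge0 ?exprn_gt0// subr_ge0 -exprMn => rxy.
have [r0|/ltW r0] := leP 0 r; last first.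
  by rewrite (le_trans r0)// mulr_ge0 ?rnorm_ge0.
by rewrite -(@ler_pXn2r _ 2)// nnegrE ?mulr_ge0 ?rnorm_ge0.
Qed.

(** Replacing x by conj <x, y> x turns the inner product into |<x, y>|^2, which is real; one factor
    then cancels. *)
Lemma rnorm_inner_le x y : rnorm (inner x y) <= rnorm x * rnorm y.
Proof.
have [i0|i0] := eqVneq (rnorm (inner x y)) 0.
  by rewrite i0 mulr_ge0 ?rnorm_ge0.
have {}i0 : 0 < rnorm (inner x y) by rewrite lt_neqAle eq_sym i0 rnorm_ge0.
have := Re_inner_le ((inner x y)^* *: x) y.
by rewrite innerZl mulrC -rnorm_sqr /= rnormZ rnormJ expr2 -mulrA ler_pM2l.
Qed.

Lemma inner_ext x y : (forall z, inner x z = inner y z) -> x = y.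
Proof.
move=> xy; apply/eqP; rewrite -subr_eq0; apply/eqP/rnorm_eq0.
have : inner (x - y) (x - y) = 0 by rewrite innerBl xy subrr.
by rewrite inner_sqr => /(congr1 (@complex.Re R)) /= /eqP; rewrite sqrf_eq0 => /eqP.
Qed.

(* [r] minimizes [|p.1|^2 - 2 Re p.2] over the closure of [D]; the parallelogram
   law makes minimizing sequences Cauchy. *)
Lemma riesz_subspace (D : set (V * R[i])) (M : R) : 0 <= M ->
  D (0, 0) ->
  (forall a p q, D p -> D q -> D (a *: p.1 + q.1, a * p.2 + q.2)) ->
  (forall p, D p -> rnorm p.2 <= M * rnorm p.1) ->
  exists r, [/\ forall p, D p -> p.2 = inner p.1 r, rnorm r <= M &
    forall e : R, 0 < e -> exists2 p, D p & rnorm (r - p.1) < e].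
Proof.
move=> M0 D0 Dlin DM.
pose J (p : V * R[i]) := rnorm p.1 ^+ 2 - 2 * complex.Re p.2.
pose m := inf (J @` D).
have Jlb : has_lbound (J @` D).
  exists (- M ^+ 2) => _ [p Dp <-]; rewrite /J.
  have := DM p Dp; have := Re_le_rnorm p.2; have := sqr_ge0 (rnorm p.1 - M).
  by move: (rnorm p.1) (rnorm p.2) => s t; nra.
have Jm p : D p -> m <= J p by move=> Dp; apply: ge_inf => //; exists p.
have DJ e : 0 < e -> exists2 p, D p & J p < m + e.
  move=> e0; have [|_ [p Dp <-] pe] := @inf_adherent _ (J @` D) e e0.
    by split=> //; exists (J (0, 0)), (0, 0).
  by exists p.
have para p q : D p -> D q ->
    rnorm (p.1 - q.1) ^+ 2 <= 2 * (J p + J q - 2 * m).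
  (* The lower bound [m] is applied at the midpoint of p and q. *)
  move=> Dp Dq; have := Dlin (2^-1)%:C _ _ (Dlin 1 _ _ Dp Dq) D0.
  move=> /Jm; rewrite /J /= !addr0 !scale1r !mul1r.
  rewrite rnormZ_real ReZ ReD exprMn real_normK ?num_real// !rnormD_sqr.
  rewrite rnormN innerNr ReN; move: (complex.Re (inner _ _)) => s.
  by move: (rnorm p.1) (rnorm q.1) (complex.Re _) (complex.Re _) => *; lra.
pose B (e : R) := [set x | exists p, [/\ D p, x = p.1 & J p < m + e]].
pose F := filter_from [set e : R | 0 < e] B.
have FF : ProperFilter F.
  apply: filter_from_proper; last first.
    by move=> e /DJ[p Dp pe]; exists p.1, p.
  apply: filter_from_filter; first by exists 1; rewrite /= ltr01.
  move=> d e d0 e0; exists (Num.min d e); first by rewrite /= lt_min d0.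
  move=> _ [p [Dp -> pde]]; split; exists p; split=> //;
    apply: (lt_le_trans pde); by rewrite lerD2l ge_min lexx ?orbT.
have Fc : cauchy F.
  apply: (@cauchy_exP _ V F _) => _/lt0cP[e e0 ->].
  have d0 : 0 < e ^+ 2 / 4 by rewrite divr_gt0 ?exprn_gt0.
  have [p Dp pd] := DJ _ d0.
  exists p.1; exists (e ^+ 2 / 4) => // _ [q [Dq -> qd]].
  rewrite -ball_normE /ball_/= rnorm_lt -(@ltr_pXn2r _ 2)// ?nnegrE ?rnorm_ge0 ?ltW//.
  by apply: (le_lt_trans (para _ _ Dp Dq)); lra.
have [r Fr] : exists r : V, F --> r.
  by exists (lim F); exact: (@cauchy_cvg V F _ Fc).
have approx e : 0 < e -> exists p, [/\ D p, J p < m + e & rnorm (r - p.1) < e].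
  move=> e0.
  have FB : F (B e) by exists e.
  have Fb : F [set y | rnorm (r - y) < e].
    by apply: Fr; apply/nbhs_rnormP; exists e.
  by have [_ [[p [Dp -> pe]] pr]] := filter_ex (filterI FB Fb); exists p.
have key p q e : D p -> D q -> J q < m + e ->
    rnorm (inner p.1 q.1 - p.2) ^+ 2 <= e * (rnorm p.1 ^+ 2 + 1).
  move=> Dp Dq qe; set w := _ - _.
  (* Moving q by -s conj(w) p lowers [J] by |w|^2 (2 s - s^2 |p|^2), which is at most e since q is
     nearly minimal; this choice of s makes the bracket at least s. *)
  set s := (rnorm p.1 ^+ 2 + 1)^-1.
  have s0 : 0 < s by rewrite invr_gt0 ltr_wpDl ?sqr_ge0.
  have sp : s * (rnorm p.1 ^+ 2 + 1) = 1.
    by rewrite mulVf// gt_eqF// ltr_wpDl ?sqr_ge0.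
  have := Jm _ (Dlin ((- s)%:C * w^*) _ _ Dp Dq).
  rewrite /J /= rnormD_sqr rnormZ rnormM rnormC rnormJ.
  rewrite innerZl -!mulrA ReD !ReZ.
  have wE : complex.Re (w^* * inner p.1 q.1) - complex.Re (w^* * p.2)
      = rnorm w ^+ 2.
    by rewrite -ReN -ReD -mulrN -mulrDr -/w mulrC -rnorm_sqr.
  rewrite normrN gtr0_norm//; move: wE qe; rewrite /J.
  move: (complex.Re (w^* * _)) (complex.Re (w^* * _)) => A C.
  move=> AC qe ineq.
  rewrite !exprMn in ineq.
  have {}ineq : rnorm w ^+ 2 * (2 * s - s ^+ 2 * rnorm p.1 ^+ 2) <= e.
    by nra.
  have ss : s <= 2 * s - s ^+ 2 * rnorm p.1 ^+ 2.
    have -> : s ^+ 2 * rnorm p.1 ^+ 2 = s * (1 - s) by rewrite -sp; ring.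
    by have := sqr_ge0 s; nra.
  have : rnorm w ^+ 2 * s <= e.
    by apply: le_trans ineq; rewrite ler_wpM2l ?sqr_ge0.
  by rewrite -ler_pdivlMr// invrK.
have rE p : D p -> p.2 = inner p.1 r.
  move=> Dp; apply/eqP; rewrite eq_sym -subr_eq0; apply/eqP/rnorm_eq0.
  apply/eqP; rewrite -sqrf_eq0 eq_le sqr_ge0 andbT.
  set N := rnorm p.1 ^+ 2.
  have N0 : 0 <= N by exact: sqr_ge0.
  apply/ler_addgt0Pl => e e0; rewrite addr0.
  (* The squared error will be at most 2 N d + 2 d (N + 1) = d (4 N + 2). *)
  pose d := Num.min 1 (e / (4 * N + 2)).
  have K0 : 0 < 4 * N + 2 by lra.
  have d0 : 0 < d by rewrite lt_min ltr01 divr_gt0.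
  have d1 : d <= 1 by rewrite ge_min lexx.
  have dK : d * (4 * N + 2) <= e by rewrite -ler_pdivlMr// ge_min lexx orbT.
  have [q [Dq qd rq]] := approx _ d0.
  have := rnormD (inner p.1 (r - q.1)) (inner p.1 q.1 - p.2).
  rewrite addrA -innerDr subrK => tri.
  have k1 := key _ _ _ Dp Dq qd; have k2 := rnorm_inner_le p.1 (r - q.1).
  have k3 : rnorm (inner p.1 (r - q.1)) ^+ 2 <= N * d.
    apply: (@le_trans _ _ (N * rnorm (r - q.1) ^+ 2)).
      by rewrite -exprMn ler_pXn2r ?nnegrE ?mulr_ge0 ?rnorm_ge0.
    rewrite ler_wpM2l// (le_trans _ (ltW rq))// expr2 ler_piMr ?rnorm_ge0//.
    by rewrite (le_trans (ltW rq)).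
  have w0 := rnorm_ge0 (inner p.1 r - p.2).
  move: k1 k3 tri w0; rewrite -/N.
  move: (rnorm (inner p.1 r - p.2)) (rnorm (inner p.1 (r - q.1)))
    (rnorm (inner p.1 q.1 - p.2)) => z y x.
  move=> k1 k3 tri w0.
  have : z ^+ 2 <= (y + x) ^+ 2 by rewrite ler_pXn2r ?nnegrE// (le_trans w0).
  have := sqr_ge0 (y - x); nra.
exists r; split=> //.
  have rM p : D p -> rnorm (inner p.1 r) <= M * rnorm p.1.
    by move=> Dp; rewrite -rE// DM.
  have [r0|r0] := eqVneq (rnorm r) 0; first by rewrite r0.
  have {}r0 : 0 < rnorm r by rewrite lt_neqAle eq_sym r0 rnorm_ge0.
  rewrite -(ler_pM2r r0); apply/ler_addgt0Pl => e e0.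
  have K0 : 0 < rnorm r + M by rewrite ltr_wpDr.
  (* |r|^2 = <r - p, r> + <p, r> is at most M |r| + (|r| + M) |r - p|, whence the tolerance. *)
  have [p [Dp _ rp]] := approx _ (divr_gt0 e0 K0).
  have h1 := rM _ Dp; have h2 := rnormD (inner (r - p.1) r) (inner p.1 r).
  have h3 := rnorm_inner_le (r - p.1) r.
  have h4 := rnormD (p.1 - r) r; rewrite subrK rnormB in h4.
  rewrite -innerDl subrK inner_sqr rnormC ger0_norm ?sqr_ge0// in h2.
  rewrite ltr_pdivlMr// in rp.
  have h5 : M * rnorm p.1 <= M * (rnorm (r - p.1) + rnorm r) by rewrite ler_wpM2l.
  lra.
by move=> e /approx[p [Dp _ rp]]; exists p.
Qed.

(** The functional <., h> on [D] is represented by some r in the closure of [D]; then h - r is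
    orthogonal to [D], so h = r. *)
Lemma dense_orth (D : set V) : D 0 ->
  (forall a x y, D x -> D y -> D (a *: x + y)) ->
  (forall h, (forall x, D x -> inner x h = 0) -> h = 0) -> dense D.
Proof.
move=> D0 Dlin Dh; apply/denseP => h e e0.
have [|||r [rE _ rD]] := @riesz_subspace
  [set p | D p.1 /\ p.2 = inner p.1 h] (rnorm h) (rnorm_ge0 _).
- by rewrite /= inner0l.
- move=> a p q [Dp ->] [Dq ->] /=; rewrite innerP1; split=> //; exact: Dlin.
- by move=> p [_ ->]; rewrite mulrC rnorm_inner_le.
have -> : h = r.
  apply/eqP; rewrite -subr_eq0; apply/eqP/Dh => x Dx.
  by rewrite innerBr -(rE (x, inner x h)) ?subrr.
by have [p [Dp _] rp] := rD _ e0; exists p.1.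
Qed.

End InnerProduct.

(** * Adjoints of bounded operators *)

Section Adjoint.
Context {U Y : hilbertType R}.

(** Riesz representation of u |-> <T u, y> gives the value at each y; nondegeneracy of the inner
    product makes it linear in y. *)
Lemma is_adjoint_ex (T : {linear U -> Y}) (M : R) : 0 <= M ->
  (forall u, rnorm (T u) <= M * rnorm u) -> exists S, is_adjoint T S.
Proof.
move=> M0 TM.
have Sex y : exists r, forall u, inner (T u) y = inner u r.
  have [|||r [rE _ _]] := @riesz_subspace U
    [set p | p.2 = inner (T p.1) y] (M * rnorm y) (mulr_ge0 M0 (rnorm_ge0 _)).
  - by rewrite /= linear0 inner0l.
  - by move=> a p q -> ->; rewrite /= linearP innerP1.
  - move=> p -> /=; rewrite (le_trans (rnorm_inner_le _ _))//.
    by rewrite mulrAC ler_wpM2r ?rnorm_ge0.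
  by exists r => u; exact: (rE (u, inner (T u) y)).
pose S y := projT1 (cid (Sex y)).
have SE u y : inner (T u) y = inner u (S y).
  by rewrite /S; case: cid.
have Slin : linear S.
  move=> a x y; apply: inner_ext => u.
  by rewrite -innerJ -SE !innerE -(innerJ _ (S x)) -(innerJ _ (S y)) !SE
    rmorphD rmorphM /= conjcK.
pose mS := GRing.isLinear.Build R[i] Y U *:%R S Slin.
pose SL : {linear Y -> U} := HB.pack S mS.
by exists SL => u y; exact: SE.
Qed.

Lemma adjointP (T : {linear U -> Y}) :
  (exists S, is_adjoint T S) -> is_adjoint T (adjoint T).
Proof. by move=> TS; rewrite /adjoint; case: pselect => // ?; case: cid. Qed.

End Adjoint.

Lemma adjointK (U Y : hilbertType R) (T : {linear U -> Y}) u :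
  (exists S, is_adjoint T S) -> adjoint (adjoint T) u = T u.
Proof.
move=> /adjointP TS; apply: inner_ext => y.
have aT : is_adjoint (adjoint T) T by move=> v w; rewrite -innerJ -TS innerJ.
by rewrite -innerJ -adjointP ?innerJ ?TS//; exists T.
Qed.

End HilbertSpace.

(** * The colligation spanned by the kernel functions *)

Section ReproducingKernel.
Local Open Scope complex_scope.
Local Notation "x ^*" := (conjc x) : ring_scope.
Set Implicit Arguments.
Unset Strict Implicit.
Context {R : realType} {U Y : hilbertType R}.
Context {phi : rhp R -> {linear U -> Y}} (phi_schur : schur phi).
Implicit Types (a l m : rhp R) (u : U) (y : Y).

Lemma Re_val_gt0 a : 0 < complex.Re (val a).
Proof. exact: (valP a). Qed.

Lemma val_conj_rhp a : val (conj_rhp a) = (val a)^*.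
Proof. by []. Qed.

Lemma conj_rhpK a : conj_rhp (conj_rhp a) = a.
Proof. by apply/val_inj; rewrite /= conjcK. Qed.

Lemma rhpD_neq0 a m : val a + val m != 0.
Proof.
have := addr_gt0 (Re_val_gt0 a) (Re_val_gt0 m).
by rewrite -ReD; case: eqP => // ->; rewrite ltxx.
Qed.

Lemma rhpDJ_neq0 a m : val a + (val m)^* != 0.
Proof. exact: (rhpD_neq0 a (conj_rhp m)). Qed.

Lemma schur_adjoint l : exists S, is_adjoint (phi l) S.
Proof.
apply: (@is_adjoint_ex _ _ _ _ 1) => // u.
by rewrite mul1r -lecR -!rnormE; have [+ _] := phi_schur; exact.
Qed.

Lemma inner_phi l u y : inner (phi l u) y = inner u (adjoint (phi l) y).
Proof. exact/adjointP/schur_adjoint. Qed.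

Lemma inner_adjoint_phi l u y :
  inner (adjoint (phi l) y) u = inner y (phi l u).
Proof. by rewrite -innerJ -inner_phi innerJ. Qed.

Lemma inner_phit l u y : inner (phit phi l y) u = inner y (phi (conj_rhp l) u).
Proof. exact: inner_adjoint_phi. Qed.

Lemma adjoint_phit l u : adjoint (phit phi l) u = phi (conj_rhp l) u.
Proof. exact/adjointK/schur_adjoint. Qed.

(** At m = a both sides vanish, so the multiplied form hides the removed singularity. *)
Lemma diff_quotM (V : normedModType R[i]) (f : rhp R -> V) a m :
  (val a - val m) *: diff_quot f a m = f m - f a.
Proof.
rewrite /diff_quot; case: eqVneq => [->|ma]; first by rewrite !subrr scale0r.
rewrite scalerA divff ?scale1r// subr_eq0; apply: contra ma => /eqP/val_inj ->.
exact: eqxx.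
Qed.

(** * Kernel functions and their energy balance *)

Context (H : rkhs (Ks phi)).
Implicit Types x z : H.

Lemma ker1_ex l y : exists2 k : H, rk_fun k = Ks phi l l y 0 &
  forall x, inner ((rk_fun x).1 l) y = inner x k.
Proof.
have [k kE xk] := rk_reproducing H l l y 0.
by exists k => // x; rewrite -xk inner0r addr0.
Qed.

Lemma ker2_ex l u : exists2 k : H, rk_fun k = Ks phi l l 0 u &
  forall x, inner ((rk_fun x).2 l) u = inner x k.
Proof.
have [k kE xk] := rk_reproducing H l l 0 u.
by exists k => // x; rewrite -xk inner0r add0r.
Qed.

Definition ker1 l y : H := projT1 (cid2 (ker1_ex l y)).
Definition ker2 l u : H := projT1 (cid2 (ker2_ex l u)).

Lemma inner_ker1 l y x : inner ((rk_fun x).1 l) y = inner x (ker1 l y).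
Proof. by rewrite /ker1; case: cid2. Qed.

Lemma inner_ker2 l u x : inner ((rk_fun x).2 l) u = inner x (ker2 l u).
Proof. by rewrite /ker2; case: cid2. Qed.

Lemma ker1_inner l y x : inner y ((rk_fun x).1 l) = inner (ker1 l y) x.
Proof. by rewrite -innerJ inner_ker1 innerJ. Qed.

Lemma ker2_inner l u x : inner u ((rk_fun x).2 l) = inner (ker2 l u) x.
Proof. by rewrite -innerJ inner_ker2 innerJ. Qed.

Lemma rk_ker1 l y : rk_fun (ker1 l y) = Ks phi l l y 0.
Proof. by rewrite /ker1; case: cid2. Qed.

Lemma rk_ker2 l u : rk_fun (ker2 l u) = Ks phi l l 0 u.
Proof. by rewrite /ker2; case: cid2. Qed.

(** The four kernel formulas are kept multiplied by their denominators, two of which vanish at m =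
    conj l, where the kernel has a removed singularity. *)
Lemma ker1_fst l y m :
  (val m + (val l)^*) *: (rk_fun (ker1 l y)).1 m =
    y - phi m (adjoint (phi l) y).
Proof.
rewrite rk_ker1 /= scalerDr scalerA divff ?rhpDJ_neq0// scale1r.
rewrite (_ : (fun _ => _) = fun=> 0); first by rewrite diff_quot_cst scaler0 addr0.
by apply/funext => ?; rewrite linear0.
Qed.

Lemma ker1_snd l y m :
  ((val l)^* - val m) *: (rk_fun (ker1 l y)).2 m =
    phit phi m y - adjoint (phi l) y.
Proof.
rewrite rk_ker1 /= scalerDr !linear0 addr0 !scaler0 addr0.
by rewrite -val_conj_rhp diff_quotM /phit conj_rhpK.
Qed.

Lemma ker2_fst l u m :
  ((val l)^* - val m) *: (rk_fun (ker2 l u)).1 m =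
    phi m u - phi (conj_rhp l) u.
Proof.
rewrite rk_ker2 /= scalerDr !linear0 addr0 !scaler0 add0r.
by rewrite -val_conj_rhp diff_quotM.
Qed.

Lemma ker2_snd l u m :
  (val m + (val l)^*) *: (rk_fun (ker2 l u)).2 m =
    u - phit phi m (phi (conj_rhp l) u).
Proof.
rewrite rk_ker2 /= scalerDr scalerA divff ?rhpDJ_neq0// scale1r adjoint_phit.
rewrite (_ : (fun _ => _) = fun=> 0); first by rewrite diff_quot_cst scaler0 add0r.
by apply/funext => ?; rewrite linear0.
Qed.

(* The span of the quadruples [(x, u, z, y)] with [x] a kernel function,
   [A&B (x, u) = z] and [C&D (x, u) = y]. *)
Inductive colligation : H -> U -> H -> Y -> Prop :=
| colligation_ker1 l y : colligation (ker1 l y) (adjoint (phi l) y)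
    (- (val l)^* *: ker1 l y) y
| colligation_ker2 l u : colligation (ker2 l u) u
    ((val l)^* *: ker2 l u) (phi (conj_rhp l) u)
| colligationP c x u z y x' u' z' y' :
    colligation x u z y -> colligation x' u' z' y' ->
    colligation (c *: x + x') (c *: u + u') (c *: z + z') (c *: y + y').

Lemma colligation0 l : colligation 0 0 0 0.
Proof.
have k := colligation_ker2 l 0.
by have := colligationP (-1) k k; rewrite !scaleN1r !addNr.
Qed.

(** Both sides are linear in the first vector and conjugate linear in the second, so generators
    suffice. There the scalars combine to the denominator of a kernel entry, and the reproducing
    property reduces the identity to the formula for that entry. *)
Lemma colligation_energy x u z y x' u' z' y' :
  colligation x u z y -> colligation x' u' z' y' ->
  inner z x' + inner x z' = inner u u' - inner y y'.
Proof.
move=> n; elim: n x' u' z' y' => {x u z y}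
  [l y|l u|c x u z y w v t s _ IH1 _ IH2] x' u' z' y' n'; last first.
- have := IH1 _ _ _ _ n'; have := IH2 _ _ _ _ n' => e1 e2.
  rewrite !innerE addrACA -mulrDr e1 e2; ring.
- elim: n' => {x' u' z' y'} [m y'|m u'|c x u' z y w v t s _ IH1 _ IH2].
  + rewrite !innerE rmorphN /= conjcK -mulrDl -inner_ker1.
    rewrite -innerZl ker2_fst innerBl inner_phi; ring.
  + rewrite !innerE /= conjcK -mulrDl -inner_ker2 addrC.
    by rewrite -innerZl ker2_snd innerBl inner_phit.
  + by rewrite !innerDr !innerZr addrACA -mulrDr IH1 IH2; ring.
- elim: n' => {x' u' z' y'} [m y'|m u'|c x u' z y' w v t s _ IH1 _ IH2].
  + rewrite !innerE rmorphN /= conjcK -mulrDl -inner_ker1.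
    rewrite -opprD mulNr addrC -innerZl ker1_fst innerBl inner_phi; ring.
  + rewrite !innerE /= conjcK -mulrDl -inner_ker2.
    rewrite addrC -opprB mulNr -innerZl ker1_snd innerBl inner_phit; ring.
  + by rewrite !innerDr !innerZr addrACA -mulrDr IH1 IH2; ring.
Qed.

Lemma colligation_norm x u z y : colligation x u z y ->
  2 * complex.Re (inner z x) = rnorm u ^+ 2 - rnorm y ^+ 2.
Proof.
move=> n; have := colligation_energy n n.
rewrite !inner_sqr => /(congr1 (@complex.Re R)).
by rewrite -(innerJ z x) !ReD ReN ReJ /= => <-; ring.
Qed.

(** For y = 0 the energy balance gives Re <z, x> >= 0, so Re a |x|^2 <= Re <conj a x + z, x>;
    Cauchy-Schwarz concludes. *)
Lemma colligation_le1 a x u z : colligation x u z 0 ->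
  rnorm x <= (complex.Re (val a))^-1 * rnorm ((val a)^* *: x + z).
Proof.
move=> /colligation_norm; rewrite rnorm0 expr0n subr0 => n.
have a0 := Re_val_gt0 a.
have := Re_inner_le ((val a)^* *: x + z) x.
rewrite innerDl innerZl inner_sqr ReD mulrC ReZ ReJ => le.
have [->|x0] := eqVneq (rnorm x) 0; first by rewrite mulr_ge0 ?invr_ge0 ?rnorm_ge0// ltW.
have {}x0 : 0 < rnorm x by rewrite lt_neqAle eq_sym x0 rnorm_ge0.
rewrite ler_pdivlMl// -(ler_pM2r x0); have := sqr_ge0 (rnorm u); nra.
Qed.

(** For u = 0 the sign is opposite: Re <z, x> <= 0. *)
Lemma colligation_le2 a x z y : colligation x 0 z y ->
  rnorm x <= (complex.Re (val a))^-1 * rnorm ((val a)^* *: x - z).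
Proof.
move=> /colligation_norm; rewrite rnorm0 expr0n sub0r => n.
have a0 := Re_val_gt0 a.
have := Re_inner_le ((val a)^* *: x - z) x.
rewrite innerBl innerZl inner_sqr ReD ReN mulrC ReZ ReJ => le.
have [->|x0] := eqVneq (rnorm x) 0; first by rewrite mulr_ge0 ?invr_ge0 ?rnorm_ge0// ltW.
have {}x0 : 0 < rnorm x by rewrite lt_neqAle eq_sym x0 rnorm_ge0.
rewrite ler_pdivlMl// -(ler_pM2r x0); have := sqr_ge0 (rnorm y); nra.
Qed.

(* [r] represents the functional [conj a z + w |-> <z, x> - <y, x_1(a)>] on
   colligation vectors [(z, u, w, y)]. It is bounded because subtracting the
   vector of [ker1 a y] changes neither side and reduces to [y = 0]. *)
Lemma resolvent_ex a x : exists r : H, [/\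
  forall m, (val a - val m) *: (rk_fun r).1 m =
    (rk_fun x).1 m - (rk_fun x).1 a,
  forall m, (val a + val m) *: (rk_fun r).2 m =
    (rk_fun x).2 m - phit phi m ((rk_fun x).1 a) &
  rnorm r <= (complex.Re (val a))^-1 * rnorm x].
Proof.
have a0 := Re_val_gt0 a.
pose D := [set p : H * R[i] | exists z u w y, colligation z u w y /\
  p = ((val a)^* *: z + w, inner z x - inner y ((rk_fun x).1 a))].
have [||||r [rE rM _]] := @riesz_subspace _ _ D
  ((complex.Re (val a))^-1 * rnorm x).
- by rewrite mulr_ge0 ?rnorm_ge0// invr_ge0 ltW.
- exists 0, 0, 0, 0; split; first exact: (colligation0 a).
  by rewrite scaler0 addr0 !inner0l subrr.
- move=> c _ _ [z [u [w [y [n ->]]]]] [z' [u' [w' [y' [n' ->]]]]].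
  exists (c *: z + z'), (c *: u + u'), (c *: w + w'), (c *: y + y').
  split; first exact: colligationP.
  congr pair => /=; last by rewrite !innerE; ring.
  by rewrite !scalerDr !scalerA mulrC addrACA.
- move=> _ [z [u [w [y [n ->]]]]] /=.
  have := colligationP (-1) (colligation_ker1 a y) n.
  rewrite (_ : -1 *: y + y = 0) ?scaleN1r ?addNr// => /(colligation_le1 a).
  rewrite scaleNr opprK scalerDr scalerN addrACA addNr add0r => zw.
  rewrite ker1_inner -innerBl mulrAC (le_trans (rnorm_inner_le _ _))//.
  by rewrite ler_wpM2r ?rnorm_ge0// addrC.
exists r; split=> // m.
  apply: inner_ext => y; rewrite innerZl innerBl inner_ker1.
  (* Evaluated on the vector of [ker1 m y], the functional reads the first component of [r] at m;
     below, the vector of [ker2 m u] reads the second. *)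
  have := rE _ (ex_intro _ _ (ex_intro _ _ (ex_intro _ _ (ex_intro _ _
    (conj (colligation_ker1 m y) erefl))))).
  rewrite /= scaleNr -scalerBl innerZl -ker1_inner.
  move=> /(congr1 (@conjc R)); rewrite rmorphB rmorphM rmorphB /= !conjcK.
  by rewrite !innerJ => ->.
apply: inner_ext => u; rewrite innerZl innerBl inner_ker2 inner_phit.
have := rE _ (ex_intro _ _ (ex_intro _ _ (ex_intro _ _ (ex_intro _ _
  (conj (colligation_ker2 m u) erefl))))).
rewrite /= -scalerDl innerZl -ker2_inner.
move=> /(congr1 (@conjc R)); rewrite rmorphB rmorphM rmorphD /= !conjcK.
by rewrite !innerJ => ->.
Qed.

(** The dual functional is conj a z - w |-> <z, x> - <u, x_2(a)>; subtracting the vector of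
    [ker2 a u] changes neither side and reduces to u = 0. *)
Lemma dual_resolvent_ex a x : exists r : H,
  forall m, (val a - val m) *: (rk_fun r).2 m =
    (rk_fun x).2 m - (rk_fun x).2 a.
Proof.
have a0 := Re_val_gt0 a.
pose D := [set p : H * R[i] | exists z u w y, colligation z u w y /\
  p = ((val a)^* *: z - w, inner z x - inner u ((rk_fun x).2 a))].
have [||||r [rE rM _]] := @riesz_subspace _ _ D
  ((complex.Re (val a))^-1 * rnorm x).
- by rewrite mulr_ge0 ?rnorm_ge0// invr_ge0 ltW.
- exists 0, 0, 0, 0; split; first exact: (colligation0 a).
  by rewrite scaler0 subr0 !inner0l subrr.
- move=> c _ _ [z [u [w [y [n ->]]]]] [z' [u' [w' [y' [n' ->]]]]].
  exists (c *: z + z'), (c *: u + u'), (c *: w + w'), (c *: y + y').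
  split; first exact: colligationP.
  congr pair => /=; last by rewrite !innerE; ring.
  by rewrite scalerBr scalerDr !scalerA mulrC opprD addrACA.
- move=> _ [z [u [w [y [n ->]]]]] /=.
  have := colligationP (-1) (colligation_ker2 a u) n.
  rewrite (_ : -1 *: u + u = 0) ?scaleN1r ?addNr// => /(colligation_le2 a).
  rewrite scalerDr scalerN opprD opprK addrACA addNr add0r => zw.
  rewrite ker2_inner -innerBl mulrAC (le_trans (rnorm_inner_le _ _))//.
  by rewrite ler_wpM2r ?rnorm_ge0// addrC.
exists r => m; apply: inner_ext => u; rewrite innerZl innerBl inner_ker2.
have := rE _ (ex_intro _ _ (ex_intro _ _ (ex_intro _ _ (ex_intro _ _
  (conj (colligation_ker2 m u) erefl))))).
rewrite /= -scalerBl innerZl -ker2_inner.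
move=> /(congr1 (@conjc R)); rewrite rmorphB rmorphM rmorphB /= !conjcK.
by rewrite !innerJ => ->.
Qed.

End ReproducingKernel.

(** * Analyticity of the elements of the model space *)

Section Evaluation.
Set Implicit Arguments.
Unset Strict Implicit.
Context {R : realType} {H : hilbertType R} {V : normedModType R[i]}.
(** [ev] stands for either component of the elements of H_s, so that one argument serves both. *)
Context (ev : H -> rhp R -> V).
Context (ev_le : forall x m,
  2 * complex.Re (val m) * rnorm (ev x m) ^+ 2 <= rnorm x ^+ 2).

Lemma ev_vanishing x (e : R) : 0 < e ->
  exists M : R, forall m, M < complex.Re (val m) -> rnorm (ev x m) < e.
Proof.
move=> e0; exists (rnorm x ^+ 2 / e ^+ 2) => m.
rewrite ltr_pdivrMr ?exprn_gt0// => xm; have := ev_le x m.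
have m0 := Re_val_gt0 m; have v0 := rnorm_ge0 (ev x m).
have [//|ve] := ltP (rnorm (ev x m)) e.
have : e ^+ 2 <= rnorm (ev x m) ^+ 2 by rewrite ler_pXn2r ?nnegrE// ltW.
move: (rnorm (ev x m) ^+ 2) (e ^+ 2) xm => s t; nra.
Qed.

Lemma ev_constant x c : (forall m, ev x m = c) -> c = 0.
Proof.
move=> xc; apply: rnorm_eq0; apply/eqP; rewrite eq_le rnorm_ge0 andbT.
apply/ler_addgt0Pl => e e0; rewrite addr0.
have [M xM] := ev_vanishing x e0.
(* A real point of the half-plane beyond M. *)
have m0 : 0 < complex.Re ((Num.max M 0 + 1)%:C%C : R[i]).
  by rewrite /= ltr_wpDl// le_max lexx orbT.
pose m : rhp R := exist (fun l : R[i] => is_true (0 < complex.Re l)) _ m0.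
rewrite -(xc m); apply/ltW/xM => /=.
by rewrite -[ltLHS]addr0 ler_ltD// le_max lexx.
Qed.

Context (ev_quot : forall x a, exists r, forall m,
  (val a - val m) *: ev r m = ev x m - ev x a).

(** The difference quotient of f at a is -ev g m, and ev g m - ev g a = (a - m) ev r m with ev r m
    bounded near a. Only the quotients of f, not f itself, come from H. *)
Lemma derive_quot (f : rhp R -> V) a g :
  (forall m, (val a - val m) *: ev g m = f m - f a) ->
  derivable_rhp f a /\ deriv_rhp f a = - ev g a.
Proof.
move=> fg.
suff fE : ((h^-1 *: (extend0 f (h *: 1 + val a) - extend0 f (val a))
    @[h --> (0 : R[i]^o)^']) --> - ev g a).
  by split; [apply/cvg_ex; exists (- ev g a)|apply: cvg_lim].
apply/cvg_rnormP => e e0; rewrite /dnbhs /within /=; apply/nbhs_rnormP.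
have [r gr] := ev_quot g a.
have a0 := Re_val_gt0 a.
pose K := rnorm r ^+ 2 / complex.Re (val a) + 1.
have K0 : 0 < K by rewrite ltr_wpDl// divr_ge0 ?sqr_ge0// ltW.
(* The first bound gives 2 Re m >= Re a, hence |ev r m| <= K; the second gives |h| K < e. *)
exists (Num.min (complex.Re (val a) / 2) (e / K)).
  by rewrite lt_min !divr_gt0.
move=> h; rewrite sub0r rnormN lt_min !ltr_pdivlMr// => /andP[ha hK] h0.
have := Re_le_rnorm (- h); rewrite rnormN ReN => hre.
have m0 : 0 < complex.Re (h + val a) by rewrite ReD; lra.
pose m : rhp R := exist (fun l : R[i] => is_true (0 < complex.Re l)) _ m0.
have -> : h *: 1 + val a = val m by rewrite /= -[_ *: _]/(h * 1) mulr1.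
rewrite !extend0_val -fg /= opprD addrCA subrr addr0.
rewrite scalerA mulrN mulVf// scaleN1r opprK addrC.
have -> : ev g m - ev g a = (- h) *: ev r m.
  by rewrite -gr /= opprD addrCA subrr addr0.
rewrite rnormZ rnormN; apply: le_lt_trans hK.
rewrite ler_wpM2l ?rnorm_ge0//.
have := ev_le r m; rewrite /= ReD => rm.
have : complex.Re (val a) * rnorm (ev r m) ^+ 2 <= rnorm r ^+ 2.
  apply: le_trans rm; rewrite ler_wpM2r ?sqr_ge0//; lra.
rewrite mulrC -ler_pdivlMr// /K.
move: (rnorm (ev r m)) (_ / _) => v N vN; have := sqr_ge0 (v - 1); nra.
Qed.

Lemma analytic_quot (f : rhp R -> V) :
  (forall a, exists g, forall m, (val a - val m) *: ev g m = f m - f a) ->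
  analytic f.
Proof. by move=> fg a; have [g /derive_quot[]] := fg a. Qed.

Lemma diff_quot_ev (f : rhp R -> V) a g :
  (forall m, (val a - val m) *: ev g m = f m - f a) ->
  forall m, diff_quot f a m = ev g m.
Proof.
move=> fg m; rewrite /diff_quot; case: eqVneq => [->|ma].
  by have [_ ->] := derive_quot fg; rewrite opprK.
rewrite -fg scalerA mulVf ?scale1r// subr_eq0.
by apply: contra ma => /eqP/val_inj ->.
Qed.

End Evaluation.

(** * Point bounds, analyticity and the action of R_a *)

Section ModelSpace.
Local Open Scope complex_scope.
Local Notation "x ^*" := (conjc x) : ring_scope.
Set Implicit Arguments.
Unset Strict Implicit.
Context {R : realType} {U Y : hilbertType R}.
Context {phi : rhp R -> {linear U -> Y}} (phi_schur : schur phi).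
Context (H : rkhs (Ks phi)).
Implicit Types (a b m : rhp R) (u : U) (y : Y) (x : H) (z : fpair U Y).

(** Used with b = Re m, X = |x|, t the norm of a point value of x and k the norm of the kernel
    function for that value. *)
Let sqr_norm_bound (b k X t : R) : 0 < b -> 0 <= k -> 0 <= X -> 0 <= t ->
  2 * b * k ^+ 2 <= t ^+ 2 -> t ^+ 2 <= X * k -> 2 * b * t ^+ 2 <= X ^+ 2.
Proof.
move=> b0 k0 X0 t0 bk tk.
have [->|tn0] := eqVneq t 0; first by rewrite expr0n mulr0 sqr_ge0.
have t1 : 0 < t ^+ 2 by rewrite exprn_gt0// lt_neqAle eq_sym tn0.
have {}tk : (t ^+ 2) ^+ 2 <= X ^+ 2 * k ^+ 2.
  by rewrite -exprMn ler_pXn2r ?nnegrE ?mulr_ge0 ?sqr_ge0.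
rewrite -(ler_pM2r t1); have := sqr_ge0 X; nra.
Qed.

(** For y = x_1(m) one has |y|^2 = <x, ker1 m y>, and the energy balance gives 2 Re m |ker1 m y|^2
    <= |y|^2. *)
Lemma rk_fst_le x m :
  2 * complex.Re (val m) * rnorm ((rk_fun x).1 m) ^+ 2 <= rnorm x ^+ 2.
Proof.
set y := (rk_fun x).1 m.
apply: (@sqr_norm_bound _ (rnorm (ker1 H m y)));
  rewrite ?rnorm_ge0 ?Re_val_gt0//.
  have := colligation_norm phi_schur (colligation_ker1 H m y).
  rewrite innerZl inner_sqr [_ * _%:C]mulrC ReZ ReN ReJ => kE.
  by have := sqr_ge0 (rnorm (adjoint (phi m) y)); lra.
by have := Re_inner_le x (ker1 H m y); rewrite -inner_ker1 inner_sqr.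
Qed.

Lemma rk_snd_le x m :
  2 * complex.Re (val m) * rnorm ((rk_fun x).2 m) ^+ 2 <= rnorm x ^+ 2.
Proof.
set u := (rk_fun x).2 m.
apply: (@sqr_norm_bound _ (rnorm (ker2 H m u)));
  rewrite ?rnorm_ge0 ?Re_val_gt0//.
  have := colligation_norm phi_schur (colligation_ker2 H m u).
  rewrite innerZl inner_sqr [_ * _%:C]mulrC ReZ ReJ => kE.
  by have := sqr_ge0 (rnorm (phi (conj_rhp m) u)); lra.
by have := Re_inner_le x (ker2 H m u); rewrite -inner_ker2 inner_sqr.
Qed.

Let quot_fst x a : exists r : H, forall m,
  (val a - val m) *: (rk_fun r).1 m = (rk_fun x).1 m - (rk_fun x).1 a.
Proof. by have [r [rx _ _]] := resolvent_ex phi_schur a x; exists r. Qed.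

Let quot_snd x a : exists r : H, forall m,
  (val a - val m) *: (rk_fun r).2 m = (rk_fun x).2 m - (rk_fun x).2 a.
Proof. exact: dual_resolvent_ex. Qed.

Definition analytic_fst :=
  @analytic_quot R H Y (fun x => (rk_fun x).1) rk_fst_le quot_fst.

Definition analytic_snd :=
  @analytic_quot R H U (fun x => (rk_fun x).2) rk_snd_le quot_snd.

Lemma RopE a z x :
  (forall m, (val a - val m) *: (rk_fun x).1 m = z.1 m - z.1 a) ->
  (forall m, (val a + val m) *: (rk_fun x).2 m =
     z.2 m - phit phi m (z.1 a)) ->
  rk_fun x = Rop phi a z.
Proof.
move=> x1 x2; rewrite [LHS]surjective_pairing; congr pair; apply/funext => m.
  by rewrite /= (diff_quot_ev rk_fst_le quot_fst x1).
by rewrite /= -x2 scalerA mulVf ?scale1r ?rhpD_neq0.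
Qed.

Lemma rk_resolvent a x : rk_fun (Rval H a (rk_fun x)) = Rop phi a (rk_fun x).
Proof.
have [r [x1 x2 _]] := resolvent_ex phi_schur a x.
by have rE := RopE x1 x2; rewrite (RvalE rE).
Qed.

Lemma resolvent_le a x :
  rnorm (Rval H a (rk_fun x)) <= (complex.Re (val a))^-1 * rnorm x.
Proof.
have [r [x1 x2 xM]] := resolvent_ex phi_schur a x.
by have rE := RopE x1 x2; rewrite (RvalE rE).
Qed.

(** In the first component, m x_1(m) - a x_1(a) = a (x_1(m) - x_1(a)) - (a - m) x_1(m); the second
    is similar. *)
Lemma Rop_mulvar a x : Rop phi a (mulvar (rk_fun x)) =
  rk_fun (val a *: Rval H a (rk_fun x) - x).
Proof.
have [r [x1 x2 _]] := resolvent_ex phi_schur a x.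
rewrite (RvalE (RopE x1 x2)); apply/esym/RopE => m; rewrite linearB linearZ /=.
  rewrite scalerBr scalerA mulrC -scalerA x1 scalerBr scalerBl opprB.
  by rewrite addrC addrA addrNK.
rewrite scalerBr scalerA mulrC -scalerA x2 scalerBr scalerDl [phit _ _ (_ *: _)]linearZ.
by rewrite opprD addrACA subrr add0r addrC.
Qed.

(** In operator terms, (a - A_{-1})^{-1} B u is a kernel function. *)
Lemma Rop_inputfun a u :
  Rop phi a (inputfun phi u) = rk_fun (ker2 H (conj_rhp a) u).
Proof.
apply/esym/RopE => m; rewrite -(conj_rhpK a) val_conj_rhp conj_rhpK.
  by rewrite ker2_fst ?conj_rhpK.
by rewrite addrC ker2_snd// conj_rhpK.
Qed.

Lemma rk_analytic x : analytic (rk_fun x).1 /\ analytic (rk_fun x).2.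
Proof. by split; [exact: analytic_fst|exact: analytic_snd]. Qed.

(** The functions of this and the next two lemmas need not lie in H_s, but their difference
    quotients are components of elements of H_s. *)
Lemma mulvar_analytic x :
  analytic (mulvar (rk_fun x)).1 /\ analytic (mulvar (rk_fun x)).2.
Proof.
split; [apply: analytic_fst => a|apply: analytic_snd => a].
  have [r rx] := quot_fst x a; exists (val a *: r - x) => m.
  rewrite linearB linearZ /= scalerBr scalerA mulrC -scalerA rx scalerBr.
  by rewrite scalerBl opprB addrC addrA addrNK.
have [r rx] := quot_snd x a; exists (x - val a *: r) => m.
rewrite linearB linearZ /= scalerBr scalerA mulrC -scalerA rx scalerBr.
by rewrite scalerBl opprB opprK addrC addrA addrNK addrC.
Qed.

Lemma inputfun_analytic u :
  analytic (inputfun phi u).1 /\ analytic (inputfun phi u).2.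
Proof.
split; [apply: analytic_fst => a|apply: analytic_snd => a].
  exists (ker2 H (conj_rhp a) u) => m.
  by have := ker2_fst H (conj_rhp a) u m; rewrite val_conj_rhp conjcK conj_rhpK.
by exists 0 => m; rewrite linear0 scaler0 /= subrr.
Qed.

Lemma Zfun_analytic y : analytic (Zfun phi y).1 /\ analytic (Zfun phi y).2.
Proof.
split; [apply: analytic_fst => a|apply: analytic_snd => a].
  by exists 0 => m; rewrite linear0 scaler0 /= subrr.
exists (ker1 H (conj_rhp a) y) => m.
by have := ker1_snd H (conj_rhp a) y m; rewrite val_conj_rhp conjcK.
Qed.

End ModelSpace.

(** * The extrapolation space *)

Section ExtrapolationSpace.
Local Open Scope complex_scope.
Local Notation "x ^*" := (conjc x) : ring_scope.
Set Implicit Arguments.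
Unset Strict Implicit.
Context {R : realType} {U Y : hilbertType R}.
Context {phi : rhp R -> {linear U -> Y}} (phi_schur : schur phi).
Context (H : rkhs (Ks phi)) (beta : rhp R).
Implicit Types (a m : rhp R) (u : U) (y : Y) (x h w : H) (z : fpair U Y).
Implicit Types p q : Hm1 H beta.

Local Notation "'res" := (fun a x => Rval H a (rk_fun x)).
Local Notation iota := (iota_s H beta).
Local Notation class := (class_of H beta).

(** * The numerator, its classes and R_a on classes *)

Lemma Es_rk_fun x : Es H beta (rk_fun x).
Proof.
have [? ?] := rk_analytic phi_schur x; split=> //.
by exists ('res beta x); exact: rk_resolvent.
Qed.

Lemma Es_mulvar x : Es H beta (mulvar (rk_fun x)).
Proof.
have [? ?] := mulvar_analytic phi_schur x; split=> //.
by rewrite (Rop_mulvar phi_schur); eexists.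
Qed.

Lemma Es_inputfun u : Es H beta (inputfun phi u).
Proof.
have [? ?] := inputfun_analytic phi_schur H u; split=> //.
by rewrite (Rop_inputfun phi_schur H); eexists.
Qed.

Lemma Es_Zfun : Zs phi `<=` Es H beta.
Proof.
move=> _ [y _ <-]; have [? ?] := Zfun_analytic phi_schur H y; split=> //.
by exists 0; rewrite Rop_Zfun linear0.
Qed.

Lemma class_coset z : Es H beta z ->
  exists2 z' : Es_type H beta, val z' = z & class z = coset z'.
Proof.
move=> zE; have zP : z \in Es_pred H beta by rewrite inE.
by exists (Sub z zP); rewrite ?SubK// /class_of insubT.
Qed.

Lemma class_linear (c : R[i]) z1 z2 : Es H beta z1 -> Es H beta z2 ->
  class (c *: z1 + z2) = c *: class z1 + class z2.
Proof.
move=> /class_coset[z1' <- ->] /class_coset[z2' <- ->].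
rewrite -linearP /class_of; case: insubP => [z' _ zE|].
  by rewrite (val_inj zE) linearP.
by have := valP (c *: z1' + z2') => /= ->.
Qed.

Lemma class_surj q : exists2 z, Es H beta z & class z = q.
Proof.
exists (val (repr q)); first by have := valP (repr q); rewrite inE.
by rewrite /class_of valK; exact: cosetK.
Qed.

Lemma class_eqP z1 z2 : Es H beta z1 -> Es H beta z2 ->
  class z1 = class z2 <-> Zs phi (z1 - z2).
Proof.
move=> /class_coset[z1' <- ->] /class_coset[z2' <- ->]; split.
  by move/eqP; rewrite eq_coset => /asboolP.
by move=> ?; apply/eqP; rewrite eq_coset; apply/asboolP.
Qed.

(** Resolvent identity: R_a z = r + (beta - a) R_a r with r = R_beta z. *)
Lemma Rop_ex a z : Es H beta z -> exists x, rk_fun x = Rop phi a z.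
Proof.
move=> [_ _ [r rE]]; have [s [s1 s2 _]] := resolvent_ex phi_schur a r.
exists (r + (val beta - val a) *: s).
have r1 m : (val beta - val m) *: (rk_fun r).1 m = z.1 m - z.1 beta.
  by rewrite rE diff_quotM.
have r2 m : (val beta + val m) *: (rk_fun r).2 m =
    z.2 m - phit phi m (z.1 beta).
  by rewrite rE /= scalerA divff ?scale1r ?rhpD_neq0.
apply: (RopE phi_schur) => m; rewrite linearD linearZ /= scalerDr scalerA.
  rewrite mulrC -scalerA s1 scalerBr r1 addrA -scalerDl.
  rewrite [X in X *: _](_ : _ = sval beta - sval m); last by ring.
  by rewrite r1 opprB addrA addrNK.
rewrite mulrC -scalerA s2 scalerBr -linearZ r1 addrA -scalerDl.
rewrite [X in X *: _](_ : _ = sval beta + sval m); last by ring.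
by rewrite r2 linearB /= opprB addrA addrNK.
Qed.

(** [Rquot] acts on a chosen representative, which differs from z by an element of Z_s, and R_a
    annihilates Z_s. *)
Lemma rk_Rquot a z : Es H beta z ->
  rk_fun (Rquot H beta a (class z)) = Rop phi a z.
Proof.
move=> zE; rewrite /Rquot; set z0 := val _.
have z0E : Es H beta z0 by have := valP (repr (class z)); rewrite inE.
have z0z : class z0 = class z by rewrite /class_of valK; exact: cosetK.
have [x xE] := Rop_ex a z0E; rewrite (RvalE xE) xE.
have /class_eqP := z0z => /(_ z0E zE) [y _ yE].
have -> : z0 = 1 *: Zfun phi y + z by rewrite yE scale1r subrK.
have [? ?] := Zfun_analytic phi_schur H y; have [? ? _] := zE.
by rewrite Rop_linear// Rop_Zfun scaler0 add0r.
Qed.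

Lemma Rquot_is_linear a : linear (Rquot H beta a).
Proof.
move=> c p q; have [z1 E1 <-] := class_surj p; have [z2 E2 <-] := class_surj q.
apply: rk_inj; rewrite -class_linear// linearP !rk_Rquot//.
  by case: E1 E2 => [? ? _] [? ? _]; rewrite Rop_linear.
have := Es_submod_closed H beta => -[_ /(_ c z1 z2)].
rewrite !inE => /(_ E1 E2); exact.
Qed.

Lemma RquotB a p q :
  Rquot H beta a (p - q) = Rquot H beta a p - Rquot H beta a q.
Proof. exact: (zmod_morphism_linear (Rquot_is_linear a)). Qed.

Lemma Rquot_inj a : injective (Rquot H beta a).
Proof.
move=> p q /eqP; rewrite -subr_eq0 -RquotB => /eqP.
have [z zE zpq] := class_surj (p - q); rewrite -zpq => Rz.
apply/eqP; rewrite -subr_eq0 -zpq; apply/eqP.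
have -> : 0 = class 0.
  have E0 := Es_rk_fun 0; rewrite linear0 in E0.
  by have := class_linear (-1) E0 E0; rewrite scaler0 addr0 scaleN1r addNr.
apply/class_eqP => //; first by have := Es_rk_fun 0; rewrite linear0.
by rewrite subr0; apply: (@Rop_eq0 _ _ _ _ a); rewrite -rk_Rquot// Rz linear0.
Qed.

(** * Algebra of the embedding, A_{-1} and B *)

Lemma iota_linear : linear iota.
Proof.
move=> c x h; rewrite /iota_s linearP.
by apply: class_linear; exact: Es_rk_fun.
Qed.

Lemma iotaB x w : iota (x - w) = iota x - iota w.
Proof. exact: (zmod_morphism_linear iota_linear). Qed.

Lemma iotaZ (c : R[i]) x : iota (c *: x) = c *: iota x.
Proof. exact: (scalable_linear iota_linear). Qed.

Lemma iota0 : iota 0 = 0.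
Proof. by rewrite -[X in iota X](subrr 0) iotaB subrr. Qed.

Lemma Am1_linear : linear (Am1 H beta).
Proof.
move=> c x h; rewrite /Am1 -class_linear; [|exact: Es_mulvar..].
rewrite linearP; congr class; congr pair; apply/funext => m /=.
  by rewrite !fctE scalerDr !scalerA mulrC.
by rewrite !fctE scalerDr opprD !scalerA scalerN scalerA mulrC.
Qed.

Lemma Am1B x w : Am1 H beta (x - w) = Am1 H beta x - Am1 H beta w.
Proof. exact: (zmod_morphism_linear Am1_linear). Qed.

Lemma Am10 : Am1 H beta 0 = 0.
Proof. by rewrite -[X in Am1 _ _ X](subrr 0) Am1B subrr. Qed.

Lemma Bs_linear : linear (Bs H beta).
Proof.
move=> c u v; rewrite /Bs -class_linear; [|exact: Es_inputfun..].
congr class; congr pair; apply/funext => m /=.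
by rewrite !fctE linearP.
Qed.

Lemma Rquot_iota a x : Rquot H beta a (iota x) = 'res a x.
Proof.
apply: rk_inj; rewrite rk_Rquot; last exact: Es_rk_fun.
by rewrite rk_resolvent.
Qed.

Lemma Rquot_Am1 a x :
  Rquot H beta a (Am1 H beta x) = val a *: Rquot H beta a (iota x) - x.
Proof.
apply: rk_inj; rewrite rk_Rquot; last exact: Es_mulvar.
by rewrite Rquot_iota (Rop_mulvar phi_schur).
Qed.

Lemma Rquot_Bs u :
  Rquot H beta beta (Bs H beta u) = ker2 H (conj_rhp beta) u.
Proof.
apply: rk_inj; rewrite rk_Rquot; last exact: Es_inputfun.
by rewrite (Rop_inputfun phi_schur H).
Qed.

Lemma RquotK a x : Rquot H beta a (val a *: iota x - Am1 H beta x) = x.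
Proof.
rewrite RquotB (scalable_linear (Rquot_is_linear a)) Rquot_Am1.
by rewrite opprB addrC addrNK.
Qed.

(** By [RquotK] both sides have the same image under the injective R_a. *)
Lemma Rquot_resolvent a q :
  val a *: iota (Rquot H beta a q) - Am1 H beta (Rquot H beta a q) = q.
Proof. by apply: (@Rquot_inj a); rewrite RquotK. Qed.

(** The output y enters only through an element of Z_s, so its existence is an equality of
    classes. *)
Lemma AsBsP x u w :
  AsBs H ((x, u), w) <-> iota w = Am1 H beta x + Bs H beta u.
Proof.
rewrite -[Am1 H beta x]scale1r /Am1 /Bs -class_linear;
  [|exact: Es_mulvar|exact: Es_inputfun].
have E : Es H beta (1 *: mulvar (rk_fun x) + inputfun phi u).
  have := Es_submod_closed H beta => -[_ /(_ 1 (mulvar (rk_fun x)) (inputfun phi u))].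
  by rewrite !inE => /(_ (Es_mulvar x) (Es_inputfun u)); exact.
have ZN y : Zfun phi (- y) = - Zfun phi y.
  by congr pair; apply/funext => m //=; rewrite linearN.
have cE := class_eqP (Es_rk_fun w) E; rewrite scale1r in cE *.
split=> [[y /= wE]|/cE[y _ yE]].
  by apply/cE; exists (- y) => //; rewrite wE ZN addrC addKr.
by exists (- y); rewrite /Ss /= ZN opprK yE addrC subrK.
Qed.

Lemma AsP x w : As H (x, w) <-> iota w = Am1 H beta x.
Proof.
rewrite /As /= AsBsP.
by rewrite -[X in Bs _ _ X](subrr 0) (zmod_morphism_linear Bs_linear) subrr addr0.
Qed.

(** R_a iota x is (a - A_s)^{-1} x and so lies in dom A_s. *)
Lemma As_Rquot a x : As H (Rquot H beta a (iota x),
  val a *: Rquot H beta a (iota x) - x).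
Proof.
by apply/AsP; apply: (@Rquot_inj a); rewrite Rquot_Am1 iotaB iotaZ RquotB
  (scalable_linear (Rquot_is_linear a)).
Qed.

Lemma rnorm_Hm1 q : rnorm q = rnorm (Rquot H beta beta q).
Proof. by []. Qed.

Lemma rnorm_iota x :
  rnorm (iota x) <= (complex.Re (val beta))^-1 * rnorm x.
Proof. by rewrite rnorm_Hm1 Rquot_iota resolvent_le. Qed.

Lemma rnorm_Am1 x : rnorm (Am1 H beta x) <=
  (rnorm (val beta) * (complex.Re (val beta))^-1 + 1) * rnorm x.
Proof.
rewrite rnorm_Hm1 Rquot_Am1 Rquot_iota (le_trans (rnormD _ _))//.
rewrite rnormZ rnormN mulrDl mul1r lerD2r -mulrA ler_wpM2l ?rnorm_ge0//.
exact: resolvent_le.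
Qed.

(** With c = 1 / Re beta, the energy balance bounds the squared norm of the kernel function by c
    |u|^2; the constant 1 + c avoids a square root. *)
Lemma rnorm_Bs u : rnorm (Bs H beta u) <=
  (1 + (complex.Re (val beta))^-1) * rnorm u.
Proof.
rewrite rnorm_Hm1 Rquot_Bs.
have b0 := Re_val_gt0 beta.
have := colligation_norm phi_schur (colligation_ker2 H (conj_rhp beta) u).
rewrite innerZl inner_sqr [_ * _%:C]mulrC ReZ ReJ val_conj_rhp ReJ.
have := sqr_ge0 (rnorm (phi (conj_rhp (conj_rhp beta)) u)).
have := rnorm_ge0 (ker2 H (conj_rhp beta) u); have := rnorm_ge0 u.
move: (rnorm (phi _ _)) (rnorm u) (rnorm (ker2 _ _ _)) => s t k t0 k0 s0 kE.
have : (complex.Re (val beta))^-1 * complex.Re (val beta) = 1.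
  by rewrite mulVf ?gt_eqF.
have : 0 < (complex.Re (val beta))^-1 by rewrite invr_gt0.
move: (complex.Re (val beta)) (complex.Re (val beta))^-1 b0 kE => b c b0 kE c0 cb.
have kb : 2 * b * k ^+ 2 <= t ^+ 2 by lra.
have : k ^+ 2 <= c * t ^+ 2.
  have : c * (2 * b * k ^+ 2) <= c * t ^+ 2 by rewrite ler_wpM2l// ltW.
  have -> : c * (2 * b * k ^+ 2) = 2 * k ^+ 2 by rewrite -[2 * k ^+ 2]mul1r -cb; ring.
  by have := sqr_ge0 k; lra.
have K0 : 0 <= (1 + c) * t by rewrite mulr_ge0// addr_ge0// ltW.
move=> kc; rewrite -(@ler_pXn2r _ 2)// ?nnegrE//.
by apply: (le_trans kc); rewrite exprMn ler_wpM2r ?sqr_ge0//; nra.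
Qed.

(** * Continuity, density and completeness *)

Lemma iota_continuous : continuous iota.
Proof. exact: (linear_le_continuous iota_linear rnorm_iota). Qed.

Lemma Am1_continuous : continuous (Am1 H beta).
Proof. exact: (linear_le_continuous Am1_linear rnorm_Am1). Qed.

Lemma Bs_continuous : continuous (Bs H beta).
Proof. exact: (linear_le_continuous Bs_linear rnorm_Bs). Qed.

(** The generators of [colligation] lie in the graph of the model node: here with output y, in the
    next lemma with output phi(conj m) u. *)
Lemma AsBs_ker1 m y :
  AsBs H ((ker1 H m y, adjoint (phi m) y), - (val m)^* *: ker1 H m y).
Proof.
exists y; rewrite /Ss /= linearZ; congr pair; apply/funext => l /=.
  rewrite !fctE /= -addrA -opprB -(ker1_fst H) scalerDl.
  by rewrite opprD addNKr scaleNr.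
rewrite !fctE /= -addrA -opprB -(ker1_snd H) scalerBl opprB.
by rewrite addKr scaleNr.
Qed.

Lemma AsBs_ker2 m u :
  AsBs H ((ker2 H m u, u), (val m)^* *: ker2 H m u).
Proof.
exists (phi (conj_rhp m) u).
rewrite /Ss /= linearZ; congr pair; apply/funext => l /=.
  by rewrite !fctE /= -addrA -(ker2_fst H) scalerBl addrC subrK.
by rewrite !fctE /= -addrA -(ker2_snd phi_schur H) scalerDl addKr.
Qed.

(* If [A&B (x, u) = w], then [x - ker2 (conj beta) u] is the value at
   [beta (x - ker2 (conj beta) u) - (w - beta ker2 (conj beta) u)] of the
   resolvent. A vector [h] orthogonal to all of these has a constant second
   component, which vanishes at infinity. *)
Lemma resolvent_range_dense :
  dense [set Rquot H beta beta (iota x) | x in [set: H]].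
Proof.
apply: dense_orth => [|c _ _ [x _ <-] [w _ <-]|h hR].
- by exists 0; rewrite // iota0 -[X in Rquot _ _ _ X](subrr 0) RquotB subrr.
- by exists (c *: x + w); rewrite // iota_linear Rquot_is_linear.
have col x u w : AsBs H ((x, u), w) ->
    inner x h = inner u ((rk_fun h).2 (conj_rhp beta)).
  move=> /AsBsP wE; have /AsBsP kE := AsBs_ker2 (conj_rhp beta) u.
  rewrite /= conjcK in kE.
  set k := ker2 _ _ _ in kE; rewrite ker2_inner -/k.
  apply/eqP; rewrite -subr_eq0 -innerBl; apply/eqP/hR.
  exists (val beta *: (x - k) - (w - val beta *: k)) => //.
  have wkE : iota (w - val beta *: k) = Am1 H beta (x - k).
    by rewrite iotaB wE kE opprD addrACA subrr addr0 -Am1B.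
  rewrite -[RHS](RquotK beta); congr (Rquot _ _ _ _).
  by rewrite [LHS]iotaB wkE iotaZ.
have h2 m : (rk_fun h).2 m = (rk_fun h).2 (conj_rhp beta).
  apply: inner_ext => u; have := col _ _ _ (AsBs_ker2 m u).
  by rewrite -ker2_inner -!(innerJ u) => ->.
have c0 := ev_constant (rk_snd_le phi_schur (H := H)) h2.
(* As h_2 = 0, [col] makes h orthogonal to every [ker1 m y]. *)
have h1 m : (rk_fun h).1 m = 0.
  apply: inner_ext => y; have := col _ _ _ (AsBs_ker1 m y).
  by rewrite -ker1_inner c0 inner0r -(innerJ y) => ->; rewrite conjc0 inner0l.
apply: rk_inj; rewrite linear0 [LHS]surjective_pairing.
by congr pair; apply/funext => m; rewrite ?h1 ?h2 ?c0.
Qed.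

(** The norm of q is that of R_beta q, so approximating R_beta q by some R_beta iota x approximates
    q. *)
Lemma iota_range_dense : dense (range iota).
Proof.
apply/denseP => q e e0.
have [_ [x _ <-]] := (denseP _).1 resolvent_range_dense (Rquot H beta beta q) e e0.
by rewrite -RquotB => qx; exists (iota x) => //; exists x.
Qed.

(** A difference lying in Z_s has a constant first component, which is 0 because it vanishes at
    infinity. *)
Lemma iota_inj : injective iota.
Proof.
move=> x w /class_eqP => /(_ (Es_rk_fun x) (Es_rk_fun w))[y _ yE].
apply: rk_inj; apply/eqP; rewrite -subr_eq0 -yE.
rewrite (_ : y = 0) ?Zfun0//.
apply: (ev_constant (rk_fst_le phi_schur (H := H)) (x := x - w)) => m.
by rewrite linearB -yE.
Qed.

(** R_beta is isometric, so the image filter is Cauchy in H_s; if h is its limit, the filter itself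
    tends to (beta - A_{-1}) h, which R_beta maps to h. *)
Lemma Hm1_complete : complete_space (Hm1 H beta).
Proof.
move=> F FF Fc.
have Gc : cauchy (Rquot H beta beta @ F).
  apply: cauchy_exP => _/lt0cP[e e0 ->].
  have /cauchyP/(_ e%:C) := Fc; rewrite ltcR => /(_ e0)[q Fq].
  exists (Rquot H beta beta q).
  apply: (@filterS _ F _ (ball q e%:C)) => // p.
  by rewrite -!ball_normE /ball_/= -RquotB.
have [h Gh] : exists h : H, Rquot H beta beta @ F --> h.
  by exists (lim (Rquot H beta beta @ F)); exact: (@cauchy_cvg H _ _ Gc).
apply/cvg_ex; exists (val beta *: iota h - Am1 H beta h).
move/cvg_rnormP : Gh => Gh A /nbhs_rnormP[e e0 eA].
apply: filterS (Gh _ e0) => p /= hp; apply: eA.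
by rewrite rnorm_Hm1 RquotB (RquotK beta).
Qed.

(** * Limits at infinity and the range of the embedding *)

Lemma Re_pinfty_filter : ProperFilter (@Re_pinfty R).
Proof.
apply: filter_from_proper => [|M _].
  apply: filter_from_filter => [|M N _ _]; first by exists 0.
  exists (Num.max M N) => // l /=.
  by rewrite gt_max => /andP[].
have m0 : 0 < complex.Re ((Num.max M 0 + 1)%:C : R[i]).
  by rewrite /= ltr_wpDl// le_max lexx orbT.
exists (exist (fun l : R[i] => is_true (0 < complex.Re l)) _ m0) => /=.
by rewrite -[ltLHS]addr0 ler_ltD// le_max lexx.
Qed.

Lemma rk_fst_cvg0 x : (rk_fun x).1 @ @Re_pinfty R --> (0 : Y).
Proof.
have FF := Re_pinfty_filter; apply/cvg_rnormP => e e0.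
have [M xM] := ev_vanishing (rk_fst_le phi_schur (H := H)) x e0.
by exists M => // m /xM; rewrite /= sub0r rnormN.
Qed.

(** A representative differs from the function of x by some [Zfun phi g], whose first component is
    the constant g; the limit 0 forces g = 0. *)
Lemma representative_cvg0 z x (zfun : fpair U Y) : Es H beta z ->
  class z = iota x -> Zs phi (zfun - z) ->
  (zfun.1 @ @Re_pinfty R --> (0 : Y)) <-> zfun = rk_fun x.
Proof.
move=> zE zx zz; split=> [w0|->]; last exact: rk_fst_cvg0.
have [g _ gE] : Zs phi (zfun - rk_fun x).
  have /(class_eqP zE (Es_rk_fun x)) zx' := zx.
  have := Zs_linear 1 zz zx'; rewrite scale1r addrA subrK; exact.
apply/eqP; rewrite -subr_eq0 -gE (_ : g = 0) ?Zfun0//.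
have FF := Re_pinfty_filter.
have gF : (fun=> g) = zfun.1 - (rk_fun x).1.
  by apply/funext => m; have := congr1 (fun t => t.1 m) gE.
have : (fun=> g : Y) @ @Re_pinfty R --> (0 : Y).
  by rewrite gF -[0 in X in _ --> X]subr0; apply: cvgB => //; exact: rk_fst_cvg0.
by move=> g0; exact: (cvg_unique (@norm_hausdorff _ Y) (cvg_cst g) g0).
Qed.

Lemma iota_range_dom a q :
  (exists x, q = iota x) <-> dom (As H) (Rquot H beta a q).
Proof.
split=> [[x ->]|[[h w] /AsP wh /= hE]].
  by eexists; first exact: (As_Rquot a x).
(* With h = R_a q and w = A_s h, the class q = (a - A_{-1}) h is iota (a h - w). *)
exists (val a *: h - w); apply: (@Rquot_inj a).
by rewrite iotaB wh iotaZ RquotK.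
Qed.

Lemma resolvent_As a x h :
  resolvent (As H) (val a) (x, h) <-> h = Rquot H beta a (iota x).
Proof.
split=> [[[p w] /AsP wp [<- <-]] /=|->].
  by rewrite iotaB wp iotaZ RquotK.
exists (Rquot H beta a (iota x), val a *: Rquot H beta a (iota x) - x).
  exact: As_Rquot.
by rewrite /= opprB addrC subrK.
Qed.

(** * The graph of A_{-1}: resolvent, closedness, uniqueness *)

Local Notation graph := [set (iota x, Am1 H beta x) | x in [set: H]].

Lemma resolvent_Am1 a : resolvent graph (val a) =
  [set (q, iota (Rquot H beta a q)) | q in [set: Hm1 H beta]].
Proof.
apply/seteqP; split=> [_ [_ [x _ <-] <-]|_ [q _ <-]] /=.
  by exists (val a *: iota x - Am1 H beta x) => //; rewrite (RquotK a).
exists (iota (Rquot H beta a q), Am1 H beta (Rquot H beta a q)).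
  by exists (Rquot H beta a q).
by rewrite /= Rquot_resolvent.
Qed.

Lemma graph_Am1_operator : is_operator graph.
Proof.
split.
- by exists 0 => //; rewrite iota0 Am10.
- by move=> c _ _ [x _ <-] [w _ <-]; exists (c *: x + w) => //;
    rewrite iota_linear Am1_linear.
move=> q [x _ [x0 <-]].
have -> : x = 0 by apply: iota_inj; rewrite x0 iota0.
exact: Am10.
Qed.

Lemma Rquot_continuous : continuous (Rquot H beta beta).
Proof.
apply: (linear_le_continuous (M := 1) (Rquot_is_linear beta)) => q.
by rewrite mul1r.
Qed.

(** The vector x is recovered from p = (iota x, A_{-1} x) by a continuous formula, so the graph is
    an equalizer of continuous maps, hence closed. *)
Lemma graph_Am1E : graph = [set p : Hm1 H beta * Hm1 H beta |
  iota (val beta *: Rquot H beta beta p.1 - Rquot H beta beta p.2) = p.1].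
Proof.
apply/seteqP; split=> [_ [x _ <-]|[p q] /= pq].
  by rewrite /= Rquot_Am1 opprB addrC subrK.
set x := _ - _ in pq; exists x => //; congr pair => //.
apply: (@Rquot_inj beta); rewrite Rquot_Am1 pq.
by rewrite /x opprB addrC subrK.
Qed.

Lemma closed_graph_Am1 : closed graph.
Proof.
rewrite graph_Am1E.
apply: closed_equalizer => t; last exact: cvg_fst.
apply: (@continuous_comp _ _ _ (fun t : Hm1 H beta * Hm1 H beta =>
  val beta *: Rquot H beta beta t.1 - Rquot H beta beta t.2) iota);
  last exact: iota_continuous.
apply: cvgB.
  apply: cvgZl_tmp.
  apply: (@continuous_comp _ _ _ fst (Rquot H beta beta)); first exact: cvg_fst.
  exact: Rquot_continuous.
apply: (@continuous_comp _ _ _ snd (Rquot H beta beta)); first exact: cvg_snd.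
exact: Rquot_continuous.
Qed.

(** [G] contains (iota x, A_{-1} x) for x in a dense part of dom A_s, hence for all x by closedness;
    the domain condition and single-valuedness exclude other pairs. *)
Lemma closed_extension_unique (G : set (Hm1 H beta * Hm1 H beta)) :
  closed_operator G -> dom G = range iota ->
  (forall x w, As H (x, w) -> G (iota x, iota w)) -> G = graph.
Proof.
move=> [[_ Glin Gfun] Gclosed] Gdom GA.
have Gx x : G (iota x, Am1 H beta x).
  apply: (@closed_dense_eq _ _ _ [set x | G (iota x, Am1 H beta x)]
    resolvent_range_dense) => [|_ [w _ <-]].
    apply: (@preimage_closed _ _ (fun x => (iota x, Am1 H beta x))) => // w _.
    apply: (@cvg_pair _ _ _ (nbhs w) (nbhs (iota w)) (nbhs (Am1 H beta w))).
      exact: iota_continuous.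
    exact: Am1_continuous.
  have wA := As_Rquot beta w; have /AsP := wA => /= <-; exact: GA.
apply/seteqP; split=> [[p q] Gpq|_ [x _ <-]//].
have [x _ xp] : range iota p by rewrite -Gdom; exists (p, q).
exists x => //; rewrite xp; congr pair; apply/esym/eqP; rewrite -subr_eq0.
have := Glin (-1) _ _ (Gx x) Gpq.
rewrite xp scaleN1r (_ : _ + _ = (0, q - Am1 H beta x)); first by move/Gfun/eqP.
by congr pair => /=; [exact: addNr|exact: addrC].
Qed.

Lemma continuous_extension_unique (T : H -> Hm1 H beta) :
  continuous T -> (forall t, As H t -> T t.1 = iota t.2) -> T = Am1 H beta.
Proof.
move=> cT TA; apply/funext; apply: (closed_dense_eq resolvent_range_dense).
  by apply: closed_equalizer => //; exact: Am1_continuous.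
move=> _ [x _ <-]; have wA := As_Rquot beta x.
by have /AsP := wA => /= <-; exact: (TA _ wA).
Qed.

Lemma unitary_Rquot :
  unitary (fun p q => inner (Rquot H beta beta p) (Rquot H beta beta q))
    (@inner R H) (Rquot H beta beta).
Proof.
split=> //; first exact: Rquot_is_linear.
exists (fun h => val beta *: iota h - Am1 H beta h).
  exact: Rquot_resolvent.
exact: RquotK.
Qed.

Lemma hilbert_Hm1 : hilbert_space
  (fun p q => inner (Rquot H beta beta p) (Rquot H beta beta q)).
Proof.
split; last exact: Hm1_complete.
split=> [c p q t|p q|q]; first by rewrite Rquot_is_linear innerP1.
  by rewrite innerJ.
by rewrite inner_sqr rmorphXn /= -rnormE.
Qed.

Lemma iota_range_resolvent a z : Es H beta z ->
  (exists x, class z = iota x) <->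
  exists2 h, rk_fun h = Rop phi a z & dom (As H) h.
Proof.
move=> zE; rewrite (iota_range_dom a) -rk_Rquot//; split=> [zA|[h /rk_inj <-]//].
by exists (Rquot H beta a (class z)).
Qed.

(** Every u is the input of some vector of the domain, namely (ker2 (conj beta) u, u), and this
    determines B u. *)
Lemma control_operator_unique (B : U -> Hm1 H beta) :
  control_operator (AsBs H) iota (Am1 H beta) B -> B = Bs H beta.
Proof.
case=> _ _ BE; apply/funext => u.
have uA := AsBs_ker2 (conj_rhp beta) u.
by have /AsBsP := uA; rewrite (BE _ _ _ uA) => /addrI.
Qed.

Lemma control_operator_Bs :
  control_operator (AsBs H) iota (Am1 H beta) (Bs H beta).
Proof.
split; [exact: Bs_linear|exact: Bs_continuous|by move=> x u w /AsBsP].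
Qed.

Lemma extrapolation_space_Hm1 :
  extrapolation_space (As H) (val beta) iota.
Proof.
split; [exact: Hm1_complete|exact: iota_linear|exact: iota_range_dense|].
move=> x; exists (Rquot H beta beta (iota x)).
by split=> // [|h]; rewrite resolvent_As.
Qed.

End ExtrapolationSpace.

Theorem theorem5p1 (R : realType) (U Y : hilbertType R)
    (phi : rhp R -> {linear U -> Y}) (H : rkhs (Ks phi)) (beta : rhp R)
    (sepU : separable U) (sepY : separable Y) (phi_schur : schur phi) :
  exists ip : Hm1 H beta -> Hm1 H beta -> R[i],
  [/\ (* H_{s,-1} *)
      [/\ hilbert_space ip,
          Zs phi `<=` Es H beta &
          forall z, Es H beta z ->
            exists2 x : H, rk_fun x = Rop phi beta z &
                           `|class_of H beta z| = `|x|],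
      (* 1 *)
      [/\ [/\ forall x : H, Es H beta (rk_fun x),
              linear (iota_s H beta),
              injective (iota_s H beta),
              continuous (iota_s H beta) &
              dense (range (iota_s H beta))],
          forall z, Es H beta z ->
            let z_in_dom (a : rhp R) := exists2 h : H,
              rk_fun h = Rop phi a z & dom (As H) h in
            ((exists x : H, class_of H beta z = iota_s H beta x) <->
              (exists a, z_in_dom a)) /\
            ((exists x : H, class_of H beta z = iota_s H beta x) <->
              (forall a, z_in_dom a)) &
          forall z (x : H), Es H beta z ->
            class_of H beta z = iota_s H beta x ->
            forall w, Zs phi (w - z) ->
              (w.1 @ @Re_pinfty R --> (0 : Y)) <-> w = rk_fun x],
      (* 2 *)
      [/\ forall x : H, Es H beta (mulvar (rk_fun x)),
          forall G : set (Hm1 H beta * Hm1 H beta),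
            [/\ closed_operator G, dom G = range (iota_s H beta) &
                forall x y : H, As H (x, y) ->
                  G (iota_s H beta x, iota_s H beta y)] <->
            G = [set (iota_s H beta x, Am1 H beta x) | x in [set: H]],
          forall a : rhp R,
            (forall z, Es H beta z ->
              rk_fun (Rquot H beta a (class_of H beta z)) = Rop phi a z) /\
            resolvent [set (iota_s H beta x, Am1 H beta x) | x in [set: H]]
                (val a) =
            [set (q, iota_s H beta (Rquot H beta a q))
              | q in [set: Hm1 H beta]] &
          unitary ip (@inner R H) (Rquot H beta beta)] &
      (* 3 *)
      [/\ extrapolation_space (As H) (val beta) (iota_s H beta),
          forall T : H -> Hm1 H beta,
            continuous_extension (As H) (iota_s H beta) T <->
            T = Am1 H beta,
          forall u : U, Es H beta (inputfun phi u) &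
          forall B : U -> Hm1 H beta,
            control_operator (AsBs H) (iota_s H beta) (Am1 H beta) B <->
            B = Bs H beta]].
Proof.
have ext := AsBsP phi_schur beta.
(* The inner product of H_s is pulled back along R_beta. *)
exists (fun p q => inner (Rquot H beta beta p) (Rquot H beta beta q)); split.
- split; [exact: hilbert_Hm1|exact: Es_Zfun|move=> z zE].
  by exists (Rquot H beta beta (class_of H beta z)); first exact: rk_Rquot.
- split; first by split; [exact: Es_rk_fun|exact: iota_linear|exact: iota_inj|
    exact: iota_continuous|exact: iota_range_dense].
    move=> z zE /=; have dE a := iota_range_resolvent phi_schur a zE.
    (* The left side of [dE a] does not depend on a, so its right side for one a yields it for every
       a. *)
    split; first by rewrite (dE beta); split=> [?|[a /dE/dE//]]; exists beta.
    by rewrite (dE beta); split=> [/dE zx a|]; [exact/dE|exact].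
  by move=> z x zE zx w; exact: (representative_cvg0 phi_schur zE zx).
- split; first exact: Es_mulvar.
  + move=> G; split=> [[Gc Gd GA]|->].
      exact: (closed_extension_unique phi_schur Gc Gd GA).
    split; first by split; [exact: graph_Am1_operator|exact: closed_graph_Am1].
      apply/seteqP; split=> [_ [_ [x _ <-] <-]|_ [x _ <-]]; first by exists x.
      by exists (iota_s H beta x, Am1 H beta x) => //; exists x.
    by move=> x w /(AsP phi_schur beta) wE; exists x => //; rewrite wE.
  + move=> a; split; first by move=> z zE; exact: rk_Rquot.
    exact: resolvent_Am1.
  + exact: unitary_Rquot.
- split; first exact: extrapolation_space_Hm1.
  + move=> T; split=> [[_ cT TA]|->]; first exact: continuous_extension_unique.
    split; [exact: Am1_linear|exact: Am1_continuous|].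
    by move=> [x w] /(AsP phi_schur beta) ->.
  + exact: Es_inputfun.
  + move=> B; split=> [|->]; first exact: control_operator_unique.
    exact: control_operator_Bs.
Qed.
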